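(* Let $(E,F)$ be a complex Finsler bundle, where $\pi:E\to M$ is a holomorphic vector bundle of rank $m$ over a compact $n$-dimensional complex manifold $M$, and let $\nabla$ be its partial Bott complex connection. Let $\{F_t^2\}$, $t\in\mathbb{R}$ small, be the linear family $F_t^2=F^2+tV$ with infinitesimal deformation $V=\left(\partial F_t^2/\partial t\right)|_{t=0}$, where $t$ is sufficiently small that $F_t$ remains a (strictly pseudoconvex) complex Finsler structure on $E$. Let $V_{a\overline b}=\left(\partial h_{t\,a\overline b}/\partial t\right)|_{t=0}$, where $h_{t\,a\overline b}=\dot\partial_a\dot\partial_{\overline b}(F_t^2)$, and let $V^a_b=h^{\overline c a}V_{b\overline c}$, regarded as a section of $\mathrm{End}(V'E)$. If $\nabla V^a_b=0$, then the horizontal forms of Chern type are invariant along the family: $\mathcal{C}^h_j(\nabla_t)=\mathcal{C}^h_j(\nabla)$ for all $j$ and all such $t$, where $\nabla_t$ is the partial Bott complex connection of $(E,F_t)$.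
   Context: Coordinates: $(z^k)_{k=1}^n$ are local holomorphic coordinates on $M$, $(s_a)_{a=1}^m$ a local holomorphic frame of $E$, and $(z^k,\eta^a)$ the induced local coordinates on $E$ (the point is $\eta^a s_a(z)$). Write $\partial_k=\partial/\partial z^k$, $\dot\partial_a=\partial/\partial\eta^a$, $\dot\partial_{\overline a}=\partial/\partial\overline\eta^a$, and $E^*=E\setminus\{\text{zero section}\}$. Summation convention is used. Complex Finsler bundle: a pair $(E,F)$ with $F:E\to[0,\infty)$ such that (1) $F^2$ is smooth on $E^*$; (2) $F(z,\eta)=0$ iff $\eta=0$; (3) $F(z,\lambda\eta)=|\lambda|F(z,\eta)$ for all $\lambda\in\mathbb{C}\setminus\{0\}$; (4) the matrix $h_{a\overline b}=\dot\partial_a\dot\partial_{\overline b}(F^2)$ is positive definite on $E^*$ (strict pseudoconvexity). Chern–Finsler nonlinear connection: $N^a_k=h^{\overline c a}\,\partial_k\dot\partial_{\overline c}(F^2)$, where $(h^{\overline c a})$ is the inverse of $(h_{a\overline c})$. Set $\delta_k=\partial_k-N^a_k\dot\partial_a$ and $\delta_{\overline k}=\overline{\delta_k}$. The $\delta_k$ span the horizontal bundle $H'E$, and the $\dot\partial_a$ span the vertical bundle $V'E$, with $T'E=H'E\oplus V'E$. Partial Bott complex connection $\nabla$ of $(E,F)$: $\nabla_XY=v'[X,Y]$ for $X\in\Gamma(H'E)$, $Y\in\Gamma(V'E)$, where $v'$ is the vertical projection. Its connection form is $\omega=(\omega^a_b)$, $\omega^a_b=L^a_{bk}dz^k$, $L^a_{bk}=\dot\partial_b(N^a_k)$,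 and its horizontal curvature form is $\Omega=(\Omega^a_b)$, $\Omega^a_b=\Omega^a_{bj\overline k}\,dz^j\wedge d\overline z^k$, $\Omega^a_{bj\overline k}=-\delta_{\overline k}(L^a_{bj})$. On functions, $d^{\prime h}f=\delta_k(f)\,dz^k$; for $Z=Z^a\dot\partial_a\in\Gamma(V'E)$, $\nabla Z=(d^{\prime h}Z^a+Z^b\omega^a_b)\dot\partial_a$, and $\nabla$ is extended to sections of $\mathrm{End}(V'E)$ in the usual way, so that $\nabla V^a_b=d^{\prime h}V^a_b+\omega^a_cV^c_b-V^a_c\omega^c_b$. Horizontal forms of Chern type: $\mathcal{C}^h_j(\nabla)$ is the form on $E^*$ of bidegree $(j,j)$ in $dz,d\overline z$ defined by $\det\left(I_m-\frac{1}{2\pi i}\Omega\right)=\sum_{j=0}^m\mathcal{C}^h_j(\nabla)$. The objects for $F_t$ are given by the same formulas with $F$ replaced by $F_t$. *)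

(* Defs.v *)
From HB Require Import structures.
From mathcomp Require Import all_boot all_order all_algebra all_fingroup.
From mathcomp Require Import complex.
From mathcomp Require Import all_classical all_reals all_analysis.

Set Implicit Arguments.
Unset Strict Implicit.
Unset Printing Implicit Defensive.

Import Order.TTheory GRing.Theory Num.Theory.
Import numFieldNormedType.Exports.

Local Open Scope ring_scope.
Local Open Scope complex_scope.

(* The topology and the norm of R[i] as a numFieldType. *)
HB.instance Definition _ (R : rcfType) := NormedModule.copy R[i] R[i]^o.

(* Exterior algebra on dz^1, .., dz^n, dzbar^1, .., dzbar^n in this order; the
   value at S is the coefficient of the increasing wedge product over S. *)
Section Forms.
Variables (R : realType) (n : nat).
Local Notation C := R[i].

Definition hform := {ffun {set 'I_(n + n)} -> C}.

Definition hone : hform :=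
  [ffun S : {set 'I_(n + n)} => (S == finset.set0)%:R].

Definition wedge_sign (A B : {set 'I_(n + n)}) : C :=
  (-1) ^+ #|[set ij : 'I_(n + n) * 'I_(n + n) |
              [&& ij.1 \in A, ij.2 \in B & (ij.2 < ij.1)%N]]|.

Definition wedge (u v : hform) : hform :=
  [ffun S : {set 'I_(n + n)} => \sum_(A : {set 'I_(n + n)} | A \subset S)
     wedge_sign A (S :\: A) * u A * v (S :\: A)].

Definition dz_form (j : 'I_n) : hform :=
  [ffun S : {set 'I_(n + n)} => (S == [set lshift n j])%:R].

Definition dzbar_form (k : 'I_n) : hform :=
  [ffun S : {set 'I_(n + n)} => (S == [set rshift n k])%:R].

(* Leibniz formula; the entries will be even forms, which commute. *)
Definition form_det m (A : 'I_m -> 'I_m -> hform) : hform :=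
  \sum_(s : 'S_m) (-1) ^+ s *: \big[wedge/hone]_(a < m) A a (s a).

Definition bidegree_part (p q : nat) (u : hform) : hform :=
  [ffun S : {set 'I_(n + n)} =>
     if (#|[set j : 'I_n | lshift n j \in S]| == p) &&
        (#|[set k : 'I_n | rshift n k \in S]| == q) then u S else 0].

Local Notation dzn S := #|[set j : 'I_n | lshift n j \in S]|.
Local Notation dzbn S := #|[set k : 'I_n | rshift n k \in S]|.

Definition balanced (d : nat) (u : hform) : Prop := forall S,
  u S != 0 -> dzn S = dzbn S /\ (dzn S <= d)%N.

Lemma balancedD d u v : balanced d u -> balanced d v -> balanced d (u + v).
Proof.
move=> hu hv S; rewrite ffunE.
have [->|/hu//] := eqVneq (u S) 0; rewrite add0r; exact: hv.
Qed.

Lemma balancedZ d (c : C) u : balanced d u -> balanced d (c *: u).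
Proof.
move=> hu S; rewrite ffunE.
have [->|/hu//] := eqVneq (u S) 0; by rewrite scaler0 eqxx.
Qed.

Lemma balanced0 d : balanced d 0.
Proof. by move=> S; rewrite ffunE eqxx. Qed.

Lemma balanced1 d : balanced d hone.
Proof.
move=> S; rewrite ffunE.
have [->|_] := eqVneq S finset.set0; last by rewrite eqxx.
move=> _; suff: dzn finset.set0 = 0%N /\ dzbn finset.set0 = 0%N by case=> -> ->.
by split; apply/eqP; rewrite cards_eq0; apply/eqP/setP => i; rewrite !inE.
Qed.

Lemma card_presplit (I J : finType) (f : I -> J) (A S : {set J}) :
  A \subset S -> #|[set i | f i \in S]| =
    (#|[set i | f i \in A]| + #|[set i | f i \in S :\: A]|)%N.
Proof.
move=> AS; rewrite -(cardsID [set i | f i \in A]); congr (_ + _)%N;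
  apply: eq_card => i; rewrite !inE// andbC;
  case: (boolP (f i \in A)) => //= /(fintype.subsetP AS) -> //.
Qed.

Lemma balanced_wedge d e u v :
  balanced d u -> balanced e v -> balanced (d + e) (wedge u v).
Proof.
move=> hu hv S; rewrite ffunE => nz.
have [A AS] : exists2 A : {set 'I_(n + n)},
    A \subset S & u A != 0 /\ v (S :\: A) != 0.
  apply/exists2P; apply: contrapT => H; move/eqP: nz; apply.
  apply: big1 => A AS; apply/eqP; apply: contrapT => /negP.
  rewrite !mulf_eq0 !negb_or => /andP[/andP[_ uA] vA]; apply: H.
  by exists A.
move=> [/hu[e1 l1] /hv[e2 l2]].
by rewrite !(card_presplit _ AS) e1 e2; split=> //; rewrite -e1 -e2 leq_add.
Qed.

Lemma balanced_dz j k : balanced 1 (wedge (dz_form j) (dzbar_form k)).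
Proof.
move=> S; rewrite ffunE => nz.
have [AS vA] : [set lshift n j] \subset S /\
    S :\: [set lshift n j] = [set rshift n k].
  apply: contrapT => H; move/eqP: nz; apply; apply: big1 => A AS.
  rewrite !ffunE; have [EA|] := eqVneq A; last by rewrite mulr0 mul0r.
  have [EB|] := eqVneq (S :\: A); last by rewrite mulr0.
  by exfalso; apply: H; rewrite -EA.
have lr (i l : 'I_n) : (lshift n i == rshift n l) = false.
  by rewrite eq_lrshift.
have rl (i l : 'I_n) : (rshift n i == lshift n l) = false.
  by rewrite eq_rlshift.
rewrite !(card_presplit _ AS) vA.
have -> : [set i | lshift n i \in [set lshift n j]] = [set j].
  by apply/setP => i; rewrite !inE eq_lshift.
have -> : [set i | lshift n i \in [set rshift n k]] = finset.set0.
  by apply/setP => i; rewrite !inE lr.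
have -> : [set i | rshift n i \in [set lshift n j]] = finset.set0.
  by apply/setP => i; rewrite !inE rl.
have -> : [set i | rshift n i \in [set rshift n k]] = [set k].
  by apply/setP => i; rewrite !inE eq_rshift.
by rewrite !cards1 cards0.
Qed.

Lemma balanced_det m (A : 'I_m -> 'I_m -> hform) :
  (forall a b, balanced 1 (A a b)) -> balanced m (form_det A).
Proof.
move=> hA; rewrite /form_det; elim/big_ind: _ => [|u v|s _].
- exact: balanced0.
- exact: balancedD.
apply: balancedZ.
suff H (r : seq 'I_m) : balanced (size r) (\big[wedge/hone]_(a <- r) A a (s a)).
  have /= := H (index_enum 'I_m).
  by rewrite {1}/index_enum unlock -enumT size_enum_ord.
elim: r => [|a r IH]; first by rewrite big_nil; exact: balanced1.
by rewrite big_cons; apply: (@balanced_wedge 1).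
Qed.

Lemma bidegree_part_sum m (u : hform) : balanced m u ->
  u = \sum_(j < m.+1) bidegree_part j j u.
Proof.
move=> hu; apply/ffunP => S; rewrite sum_ffunE.
have [u0|/[dup] un0 /hu[e l]] := eqVneq (u S) 0.
  by rewrite u0 big1// => j _; rewrite ffunE u0 if_same.
rewrite (bigD1 (Ordinal (l : (dzn S < m.+1)%N)))//= big1 ?addr0.
  by rewrite ffunE -e eqxx.
move=> j /eqP jn; rewrite ffunE; case: eqP => //= E.
by exfalso; apply: jn; apply: val_inj; rewrite /= E.
Qed.

End Forms.

Local Open Scope classical_set_scope.

Record chart (R : realType) (X : topologicalType) (n : nat) := Chart {
  chart_dom : set X;
  chart_map : X -> 'rV[R[i]]_n;
  chart_inv : 'rV[R[i]]_n -> X;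
  chart_dom_open : open chart_dom;
  chart_codom_open : open (chart_map @` chart_dom);
  chart_mapK : forall x, chart_dom x -> chart_inv (chart_map x) = x;
  chart_map_cont : forall x, chart_dom x -> {for x, continuous chart_map};
  chart_inv_cont : forall x, chart_dom x ->
    {for chart_map x, continuous chart_inv} }.

(* [differentiable] is over the scalar field R[i] here: on an open set this is
   holomorphy. *)
Definition holo_compatible (R : realType) (X : topologicalType) n
    (c c' : chart R X n) : Prop :=
  forall x, chart_dom c x -> chart_dom c' x ->
    differentiable (chart_map c' \o chart_inv c) (chart_map c x).

Record complexManifold (R : realType) (n : nat) := ComplexManifold {
  carrier :> topologicalType;
  manifold_hausdorff : hausdorff_space carrier;
  manifold_second_countable : @second_countable carrier;
  atlas : set (chart R carrier n);
  atlas_cover : forall x, exists2 c, atlas c & chart_dom c x;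
  atlas_compatible : forall c c', atlas c -> atlas c' -> holo_compatible c c' }.

Arguments atlas {R n} X : rename.

Definition local_coords (R : realType) n (X : complexManifold R n)
    (c : chart R X n) : Prop :=
  forall c', atlas X c' -> holo_compatible c c' /\ holo_compatible c' c.
Arguments local_coords {R n} X c.

Definition holo_on (R : realType) n (X : complexManifold R n)
    (W : normedModType R[i]) (U : set X) (f : X -> W) : Prop :=
  forall c, atlas X c -> forall x, U x -> chart_dom c x ->
    differentiable (f \o chart_inv c) (chart_map c x).

Record frame (R : realType) n (X : complexManifold R n)
    (fib : X -> lmodType R[i]) (m : nat) :=
  Frame {
  fdom : set X;
  sec : forall x, 'I_m -> fib x;
  fdom_open : open fdom;
  frame_basis : forall x, fdom x -> forall v : fib x,
    exists! eta : 'rV[R[i]]_m, v = \sum_(a < m) eta 0 a *: sec x a }.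

Definition frame_compatible (R : realType) n (X : complexManifold R n)
    (fib : X -> lmodType R[i]) m (s s' : frame fib m) : Prop :=
  exists g : X -> 'M[R[i]]_m, holo_on (fdom s `&` fdom s') g /\
    forall x, fdom s x -> fdom s' x ->
      forall b, sec s' x b = \sum_(a < m) g x a b *: sec s x a.

(* The topology and the complex structure of the total space are the ones
   carried over from chart_dom c x C^m by the induced coordinates. *)
Record holoBundle (R : realType) n (X : complexManifold R n) (m : nat) :=
  HoloBundle {
  fib :> X -> lmodType R[i];
  frames : set (frame fib m);
  frames_cover : forall x, exists2 s, frames s & fdom s x;
  frames_compatible : forall s s', frames s -> frames s' ->
    frame_compatible s s' }.

Arguments frames {R n X m} E : rename.

Definition local_frame (R : realType) n (X : complexManifold R n) m
    (E : holoBundle X m) (s : frame E m) : Prop :=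
  forall s', frames E s' -> frame_compatible s s' /\ frame_compatible s' s.
Arguments local_frame {R n X m} E s.

Section Calculus.
Variable R : realType.
Local Notation C := R[i].

Definition cderive1 (g : R -> C) (t : R) : C :=
  Complex (derive1 (fun u => complex.Re (g u)) t)
          (derive1 (fun u => complex.Im (g u)) t).

Definition cderivable1 (g : R -> C) (t : R) : Prop :=
  derivable (fun u => complex.Re (g u)) t 1 /\
  derivable (fun u => complex.Im (g u)) t 1.

(* Derivative in the real direction v: for V = C^N, the directions e_k and
   'i *: e_k give the partial derivatives in x^k and y^k. *)
Definition rderive (V : lmodType C) (v : V) (f : V -> C) (x : V) : C :=
  cderive1 (fun t => f (x + t%:C *: v)) 0.

Definition rderivable (V : lmodType C) (v : V) (f : V -> C) (x : V) : Prop :=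
  cderivable1 (fun t => f (x + t%:C *: v)) 0.

(* Real C^k regularity on an open set D. *)
Fixpoint Ck_on (V : normedModType C) (k : nat) (D : set V) (f : V -> C) :
    Prop :=
  (forall x, D x -> {for x, continuous f}) /\
  if k is k'.+1 then forall v : V,
    (forall x, D x -> rderivable v f x) /\ Ck_on k' D (rderive v f)
  else True.

Definition smooth_on (V : normedModType C) (D : set V) (f : V -> C) : Prop :=
  forall k, Ck_on k D f.

Definition wirtinger (V : lmodType C) (v : V) (f : V -> C) (x : V) : C :=
  2^-1 * (rderive v f x - 'i * rderive ('i *: v) f x).

Definition wirtinger_bar (V : lmodType C) (v : V) (f : V -> C) (x : V) : C :=
  2^-1 * (rderive v f x + 'i * rderive ('i *: v) f x).

End Calculus.

(* Local geometry in induced coordinates (z, eta), where G stands for F^2. *)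
Section LocalFinsler.
Variables (R : realType) (n m : nat).
Local Notation C := R[i].
Local Notation P := ('rV[C]_n * 'rV[C]_m)%type.

Definition d_z (k : 'I_n) : (P -> C) -> P -> C :=
  wirtinger ((delta_mx 0 k, 0) : P).
Definition d_zbar (k : 'I_n) : (P -> C) -> P -> C :=
  wirtinger_bar ((delta_mx 0 k, 0) : P).
Definition d_eta (a : 'I_m) : (P -> C) -> P -> C :=
  wirtinger ((0, delta_mx 0 a) : P).
Definition d_etabar (a : 'I_m) : (P -> C) -> P -> C :=
  wirtinger_bar ((0, delta_mx 0 a) : P).

Definition levi (G : P -> C) (p : P) : 'M[C]_m :=
  \matrix_(a, b) d_eta a (d_etabar b G) p.

Definition nlconn (G : P -> C) (a : 'I_m) (k : 'I_n) (p : P) : C :=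
  \sum_(c < m) invmx (levi G p) c a * d_z k (d_etabar c G) p.

Definition hdelta (G : P -> C) (k : 'I_n) (f : P -> C) (p : P) : C :=
  d_z k f p - \sum_(a < m) nlconn G a k p * d_eta a f p.

Definition hdelta_bar (G : P -> C) (k : 'I_n) (f : P -> C) (p : P) : C :=
  d_zbar k f p - \sum_(a < m) (nlconn G a k p)^* * d_etabar a f p.

(* Sections of T'E, given by their components on d_z and d_eta. *)
Definition vfield := P -> P.

Definition vact (X : vfield) (f : P -> C) (p : P) : C :=
  \sum_(k < n) (X p).1 0 k * d_z k f p + \sum_(a < m) (X p).2 0 a * d_eta a f p.

Definition lie_bracket (X Y : vfield) : vfield := fun p =>
  (\row_k (vact X (fun q => (Y q).1 0 k) p - vact Y (fun q => (X q).1 0 k) p),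
   \row_a (vact X (fun q => (Y q).2 0 a) p - vact Y (fun q => (X q).2 0 a) p)).

Definition hfield (G : P -> C) (k : 'I_n) : vfield := fun p =>
  (delta_mx 0 k, - \row_a nlconn G a k p).

Definition vert (Y : P -> 'rV[C]_m) : vfield := fun p => (0, Y p).

(* Components on d_eta of the projection of Z onto V'E along H'E. *)
Definition vproj (G : P -> C) (Z : vfield) (p : P) : 'rV[C]_m :=
  \row_a ((Z p).2 0 a + \sum_(k < n) (Z p).1 0 k * nlconn G a k p).

Definition bott (G : P -> C) (X : vfield) (Y : P -> 'rV[C]_m) (p : P) :
    'rV[C]_m :=
  vproj G (lie_bracket X (vert Y)) p.

(* L^a_{bk}: nabla d_eta_b = omega^a_b d_eta_a, omega^a_b = L^a_{bk} dz^k. *)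
Definition bott_coef (G : P -> C) (a b : 'I_m) (k : 'I_n) (p : P) : C :=
  bott G (hfield G k) (fun=> delta_mx 0 b) p 0 a.

(* Coefficient of dz^k in nabla A^a_b, for A in End(V'E). *)
Definition nabla_end (G : P -> C) (A : 'I_m -> 'I_m -> P -> C)
    (a b : 'I_m) (k : 'I_n) (p : P) : C :=
  hdelta G k (A a b) p
  + \sum_(c < m) bott_coef G a c k p * A c b p
  - \sum_(c < m) A a c p * bott_coef G c b k p.

Definition curv_coef (G : P -> C) (a b : 'I_m) (j k : 'I_n) (p : P) : C :=
  - hdelta_bar G k (bott_coef G a b j) p.

Definition curv (G : P -> C) (a b : 'I_m) (p : P) : hform R n :=
  \sum_(j < n) \sum_(k < n)
    curv_coef G a b j k p *: wedge (dz_form R j) (dzbar_form R k).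

Definition chern_form (G : P -> C) (j : nat) (p : P) : hform R n :=
  bidegree_part j j (form_det (fun a b : 'I_m =>
    (a == b)%:R *: hone R n - (2 * (pi : R)%:C * 'i)^-1 *: curv G a b p)).

End LocalFinsler.

Lemma lim_opp (R : realType) (f : R -> R) :
  lim ((- f) x @[x --> (0:R)^']) = - lim (f x @[x --> (0:R)^']).
Proof.
have [cf|ncf] := pselect (cvg (f h @[h --> (0:R)^'])); first exact: limN.
have ncf' : ~ cvg ((- f) h @[h --> (0:R)^']).
  by move=> /(@is_cvgN _ _ _ _ _ _); rewrite opprK; exact: ncf.
by rewrite (dvgP ncf) (dvgP ncf') /point /= oppr0.
Qed.

Lemma derive1_opp (R : realType) (g : R -> R) t :
  derive1 (fun u => - g u) t = - derive1 g t.
Proof.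
rewrite /derive1 -lim_opp.
set f := fun h => _; set f' := - _; suff -> : f = f' by [].
by apply/funext => h; rewrite /f /f' fctE -scalerN opprD.
Qed.

Section LocalFinslerTheory.
Variables (R : realType) (n m : nat).
Local Notation C := R[i].
Local Notation P := ('rV[C]_n * 'rV[C]_m)%type.

Lemma wirtinger_cst (v : P) (z : C) p : wirtinger v (fun=> z) p = 0.
Proof.
have H w : rderive w (fun=> z : C) p = 0.
  rewrite /rderive /cderive1.
  have E (x : R) t : derive1 (fun=> x) t = 0 by exact: (derive1_cst x t).
  by rewrite !E.
by rewrite /wirtinger !H mulr0 subr0 mulr0.
Qed.

Lemma oppcE (z : C) : - z = Complex (- complex.Re z) (- complex.Im z).
Proof. by case: z. Qed.

Lemma wirtinger_opp (v : P) (f : P -> C) p :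
  wirtinger v (fun q => - f q) p = - wirtinger v f p.
Proof.
have H w : rderive w (fun q => - f q) p = - rderive w f p.
  rewrite /rderive /cderive1 [RHS]oppcE /= -!derive1_opp.
  congr (Complex (derive1 _ _) (derive1 _ _));
    by apply/funext => u; rewrite oppcE.
by rewrite /wirtinger !H mulrN -opprD mulrN.
Qed.

Lemma bott_coefE (G : P -> C) a b k p :
  bott_coef G a b k p = d_eta b (nlconn G a k) p.
Proof.
rewrite /bott_coef /bott /vproj !mxE /=.
rewrite big1 ?addr0 => [|l _]; last first.
  rewrite mxE /vact /=.
  rewrite !big1 ?addr0 ?subr0 ?mul0r// => i _.
  - by rewrite /d_eta wirtinger_cst mulr0.
  - by rewrite mxE mul0r.
  - by rewrite /d_eta wirtinger_cst mulr0.
  - by rewrite /d_z wirtinger_cst mulr0.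
rewrite /vact /=.
rewrite (_ : (fun q : P => (- \row_c nlconn G c k q) 0 a) =
             (fun q => - nlconn G a k q)); last first.
  by apply/funext => q; rewrite !mxE.
rewrite /d_z /d_eta [X in _ - (_ + X)](bigD1 b)//=.
rewrite [X in X + _ - _]big1 => [|i _]; last by rewrite wirtinger_cst mulr0.
rewrite [X in _ + X - _]big1 => [|i _]; last by rewrite wirtinger_cst mulr0.
rewrite [X in _ - (X + _)]big1 => [|i _]; last by rewrite mxE mul0r.
rewrite [X in _ - (_ + (_ + X))]big1 => [|i /negPf ib]; last first.
  by rewrite mxE ib andbF mul0r.
by rewrite wirtinger_opp mxE !eqxx mul1r add0r addr0 !add0r opprK.
Qed.

Lemma chern_form_sum (G : P -> C) p :
  form_det (fun a b : 'I_m => (a == b)%:R *: hone R n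
     - (2 * (pi : R)%:C * 'i)^-1 *: curv G a b p) =
  \sum_(j < m.+1) chern_form G j p.
Proof.
apply: bidegree_part_sum; apply: balanced_det => a b.
rewrite -scaleNr; apply: balancedD; first exact/balancedZ/balanced1.
apply: balancedZ; rewrite /curv; elim/big_ind: _ => [|u v|j _].
- exact: balanced0.
- exact: balancedD.
elim/big_ind: _ => [|u v|k _]; [exact: balanced0|exact: balancedD|].
exact/balancedZ/balanced_dz.
Qed.

End LocalFinslerTheory.

Section FinslerBundle.
Variables (R : realType) (n m : nat).
Variables (X : complexManifold R n) (E : holoBundle X m).
Local Notation C := R[i].
Local Notation P := ('rV[C]_n * 'rV[C]_m)%type.

Definition local_expr (c : chart R X n) (s : frame E m)
    (f : forall x, E x -> R) (p : P) : C :=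
  let x := chart_inv c p.1 in
  (f x (\sum_(a < m) p.2 0 a *: sec s x a))%:C.

Definition sq (F : forall x, E x -> R) : forall x, E x -> R :=
  fun x v => F x v ^+ 2.

(* The part of E minus its zero section covered by the induced coordinates. *)
Definition slit_dom (c : chart R X n) (s : frame E m) : set P :=
  [set p | (chart_map c @` (chart_dom c `&` fdom s)) p.1 /\ p.2 <> 0].

Record complex_finsler (F : forall x, E x -> R) : Prop := ComplexFinsler {
  finsler_ge0 : forall x (v : E x), 0 <= F x v;
  finsler_smooth : forall c s, local_coords X c -> local_frame E s ->
    smooth_on (slit_dom c s) (local_expr c s (sq F));
  finsler_eq0 : forall x (v : E x), F x v = 0 <-> v = 0;
  finsler_homogeneous : forall x (v : E x) (l : C), l != 0 ->
    (F x (l *: v))%:C = `|l| * (F x v)%:C;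
  finsler_pseudoconvex : forall c s, local_coords X c -> local_frame E s ->
    forall p, slit_dom c s p -> forall u : 'rV[C]_m, u != 0 ->
      0 < \sum_(a < m) \sum_(b < m)
            levi (local_expr c s (sq F)) p a b * u 0 a * (u 0 b)^* }.

Definition inf_deformation (Ft : R -> forall x, E x -> R) :
    forall x, E x -> R :=
  fun x v => derive1 (fun t => sq (Ft t) v) 0.

Definition levi_deformation (c : chart R X n) (s : frame E m)
    (Ft : R -> forall x, E x -> R) (a b : 'I_m) (p : P) : C :=
  cderive1 (fun t => levi (local_expr c s (sq (Ft t))) p a b) 0.

Definition end_deformation (c : chart R X n) (s : frame E m)
    (F : forall x, E x -> R) (Ft : R -> forall x, E x -> R)
    (a b : 'I_m) (p : P) : C :=
  \sum_(d < m) invmx (levi (local_expr c s (sq F)) p) d a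
               * levi_deformation c s Ft b d p.

End FinslerBundle.

(* Main.v *)
(** The nonlinear connection, hence all the curvature, does not change along
    the family. By the definition of N, one has delta_k h_(b cbar) =
    L^a_(bk) h_(a cbar), so lowering an index turns the hypothesis on V^a_b
    into delta_k V_(b cbar) = L^a_(bk) V_(a cbar). Contract this with eta^b:
    V is homogeneous of degree (1,1), so Euler's identity gives
    eta^b L^a_(bk) = N^a_k and eta^b d_b V_(a cbar) = 0, and what remains is
    d_k d_cbar V = N^a_k V_(a cbar). Adding t times this to
    d_k d_cbar F^2 = N^a_k h_(a cbar) shows that N solves the linear system
    that defines N_t. *)
Require Import Defs.
From mathcomp Require Import all_boot all_order all_algebra all_fingroup.
From mathcomp Require Import complex.
From mathcomp Require Import all_classical all_reals all_analysis.
From mathcomp Require Import ring.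

Set Implicit Arguments.
Unset Strict Implicit.
Unset Printing Implicit Defensive.

Import Order.TTheory GRing.Theory Num.Theory.
Import numFieldNormedType.Exports.

Local Open Scope classical_set_scope.
Local Open Scope ring_scope.

(** Derivatives here are total functions, with a default value where the limit fails to exist, and
    smoothness means continuity of the iterated derivatives along straight lines. Linearity of the
    derivative in its direction and symmetry of mixed derivatives therefore have to be proved, and
    every Leibniz rule needs its own differentiability argument. For the inverse Levi matrix, N and
    [V^a_b] a first derivative suffices: it justifies [delta_k h = L h] and its analogue for V. V
    comes with no regularity of its own. Because the family is affine, V is the difference quotient
    of [F_t^2] at a single nonzero t, and it inherits smoothness and homogeneity from [F_t] and F.
    The curvature differentiates N twice, so the two connections are compared on the whole open
    coordinate domain and not only at the given point. *)

Section ComplexDerivative.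
Local Open Scope complex_scope.
Variable R : realType.
Local Notation C := R[i].
Local Notation Re := (@complex.Re (Real.sort R)).
Local Notation Im := (@complex.Im (Real.sort R)).
Implicit Types (f g : R -> C) (t : R) (d e : C).

(** * Complex-valued functions of one real parameter *)

Lemma ReM (x y : C) : Re (x * y) =
  Re x * Re y - Im x * Im y.
Proof. by case: x y => [a b] [c e]. Qed.

Lemma ImM (x y : C) : Im (x * y) =
  Re x * Im y + Im x * Re y.
Proof. by case: x y => [a b] [c e]. Qed.

Lemma ReD (x y : C) : Re (x + y) = Re x + Re y.
Proof. by case: x y => [a b] [c e]. Qed.

Lemma ImD (x y : C) : Im (x + y) = Im x + Im y.
Proof. by case: x y => [a b] [c e]. Qed.

Lemma ReJ (x : C) : Re (x^*) = Re x.
Proof. by case: x. Qed.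

Lemma ImJ (x : C) : Im (x^*) = - Im x.
Proof. by case: x. Qed.

(** A relation rather than the value [cderive1], so that existence of the derivative travels
    together with its value. *)
Definition is_cderive f t d : Prop :=
  is_derive t 1 (fun u => Re (f u)) (Re d) /\
  is_derive t 1 (fun u => Im (f u)) (Im d).

Lemma cderivable1P f t : cderivable1 f t -> is_cderive f t (cderive1 f t).
Proof.
by move=> [h1 h2]; split; rewrite /= derive1E; exact: derivableP.
Qed.

Lemma is_cderive_val f t d : is_cderive f t d -> cderive1 f t = d.
Proof.
move=> [h1 h2]; rewrite /cderive1 !derive1E !derive_val; by case: d {h1 h2}.
Qed.

Lemma is_cderive_ex f t d : is_cderive f t d -> cderivable1 f t.
Proof. by move=> [h1 h2]; split; apply: ex_derive. Qed.

Lemma is_cderive_near f g t d : (\near t, f t = g t) ->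
  is_cderive f t d -> is_cderive g t d.
Proof.
move=> fg [h1 h2]; split.
  by apply: near_eq_is_derive h1; near=> u; rewrite (near fg u).
by apply: near_eq_is_derive h2; near=> u; rewrite (near fg u).
Unshelve. all: by end_near. Qed.

Lemma is_cderive_cst d t : is_cderive (fun=> d) t 0.
Proof. by split; exact: is_derive_cst. Qed.

Lemma is_cderiveD f g t d e : is_cderive f t d -> is_cderive g t e ->
  is_cderive (fun u => f u + g u) t (d + e).
Proof.
move=> [f1 f2] [g1 g2]; split.
  have := is_deriveD f1 g1; rewrite ReD.
  by apply: near_eq_is_derive; near=> u; rewrite fctE ?ReD ?ImD.
have := is_deriveD f2 g2; rewrite ImD.
by apply: near_eq_is_derive; near=> u; rewrite fctE ?ReD ?ImD.
Unshelve. all: by end_near. Qed.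

Lemma is_cderiveM f g t d e : is_cderive f t d -> is_cderive g t e ->
  is_cderive (fun u => f u * g u) t (d * g t + f t * e).
Proof.
move=> [f1 f2] [g1 g2]; split.
  have h := is_deriveB (is_deriveM f1 g1) (is_deriveM f2 g2).
  apply: (@near_eq_is_derive _ _ _ _ _ _ _ _ _ (is_derive_eq h _)).
    by near=> u; rewrite ReM.
  by rewrite ReD !ReM /GRing.scale /=; ring.
have h := is_deriveD (is_deriveM f1 g2) (is_deriveM f2 g1).
apply: (@near_eq_is_derive _ _ _ _ _ _ _ _ _ (is_derive_eq h _)).
  by near=> u; rewrite ImM.
by rewrite ImD !ImM /GRing.scale /=; ring.
Unshelve. all: by end_near. Qed.

Lemma is_cderive_ofreal (f : R -> R) t (d : R) : is_derive t 1 f d ->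
  is_cderive (fun u => (f u)%:C) t d%:C.
Proof. by move=> h; split => //=; exact: is_derive_cst. Qed.

Lemma is_cderive_affine (a b : C) t : is_cderive (fun u : R => a + u%:C * b) t b.
Proof.
have ht : is_cderive (fun u : R => u%:C) t 1.
  exact: (is_cderive_ofreal (is_derive_id t (1 : R))).
have := is_cderiveD (is_cderive_cst a t) (is_cderiveM ht (is_cderive_cst b t)).
by rewrite add0r mul1r mulr0 addr0.
Qed.

Lemma is_cderive_conj f t d : is_cderive f t d ->
  is_cderive (fun u => (f u)^*) t d^*.
Proof.
move=> [h1 h2]; split.
  by rewrite ReJ; apply: near_eq_is_derive h1; near=> u; rewrite ReJ.
rewrite ImJ; apply: near_eq_is_derive (is_deriveN h2).
by near=> u; rewrite ImJ.
Unshelve. all: by end_near. Qed.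

(** The inverse is the conjugate divided by the squared modulus [N], which leaves only a real
    function to invert. The value of the derivative is left open because only differentiability of
    the inverse is used later. *)
Lemma is_cderiveV f t d : f t != 0 -> is_cderive f t d ->
  exists e, is_cderive (fun u => (f u)^-1) t e.
Proof.
move=> f0 hf.
pose N u := Re (f u) ^+ 2 + Im (f u) ^+ 2.
have [e [Ne N0]] : exists e : R, is_derive t 1 N e /\ N t != 0.
  case: hf => h1 h2.
  have h := is_deriveD (is_deriveX 2 h1) (is_deriveX 2 h2).
  eexists; split; first by apply: near_eq_is_derive h; near=> u.
  by rewrite /N; case: (f t) f0 => a b /=; rewrite eq_complex /= paddr_eq0
     ?sqr_ge0// !sqrf_eq0.
have hV := is_deriveV N0 Ne.
exists (d^* * ((N t)^-1)%:C + (f t)^* * (- (N t) ^- 2 *: e)%:C).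
have := is_cderiveM (is_cderive_conj hf) (is_cderive_ofreal hV).
apply: is_cderive_near; near=> u.
rewrite /N; case: (f u) => a b.
have -> : (Complex a b)^-1 = Complex (a / (a ^+ 2 + b ^+ 2)) (- (b / (a ^+ 2 + b ^+ 2))) by [].
set c := _^-1.
have -> : (Complex a b)^*%C * c%:C = Complex (a * c - - b * 0) (a * 0 + - b * c) by [].
by congr Complex; rewrite /= -/c; ring.
Unshelve. all: by end_near. Qed.

Lemma is_cderive_sum (I : Type) (r : seq I) (P : pred I) (f : I -> R -> C)
    t (d : I -> C) : (forall i, is_cderive (f i) t (d i)) ->
  is_cderive (fun u => \sum_(i <- r | P i) f i u) t (\sum_(i <- r | P i) d i).
Proof.
move=> fd; elim: r => [|i r IH].
  rewrite big_nil; apply: is_cderive_near (is_cderive_cst 0 t).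
  by near=> u; rewrite big_nil.
rewrite big_cons; case: ifP => Pi; last first.
  by apply: is_cderive_near IH; near=> u; rewrite big_cons Pi.
apply: is_cderive_near (is_cderiveD (fd i) IH).
by near=> u; rewrite big_cons Pi.
Unshelve. all: by end_near. Qed.

Lemma is_cderive_prod (I : Type) (r : seq I) (P : pred I) (f : I -> R -> C) t :
  (forall i, exists d, is_cderive (f i) t d) ->
  exists d, is_cderive (fun u => \prod_(i <- r | P i) f i u) t d.
Proof.
move=> fd; elim: r => [|i r [d IH]].
  exists 0; apply: is_cderive_near (is_cderive_cst 1 t).
  by near=> u; rewrite big_nil.
case: (boolP (P i)) => Pi; last first.
  exists d; apply: is_cderive_near IH; near=> u.
  by rewrite big_cons (negPf Pi).
have [e fe] := fd i; eexists; apply: is_cderive_near (is_cderiveM fe IH).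
by near=> u; rewrite big_cons Pi.
Unshelve. all: by end_near. Qed.

End ComplexDerivative.

(** * Real calculus in two variables *)

Section TwoVariables.
Variable R : realType.

Lemma is_derive_shift0 (g : R -> R) (s d : R) :
  is_derive (0 : R) 1 (fun t => g (t + s)) d -> is_derive s 1 g d.
Proof.
move=> h; have h1 : is_derive s 1 (fun u : R => u - s) 1.
  by apply: (is_derive_eq (is_deriveB (is_derive_id s 1) (is_derive_cst s s 1)));
     rewrite subr0.
have h2 : is_derive (s - s) 1 (fun t => g (t + s)) d by rewrite subrr.
have h3 := @is_derive1_comp R _ (fun u => u - s) s _ _ h2 h1.
apply: (near_eq_is_derive _ (is_derive_eq h3 _)); last by rewrite mulr1.
by near=> u; rewrite /= subrK.
Unshelve. all: by end_near. Qed.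

Lemma is_derive_dist (f : R -> R) (d : R) :
  (forall e, 0 < e -> exists2 r, 0 < r &
    forall h : R, h != 0 -> `|h| < r -> `|h^-1 * (f h - f 0) - d| < e) ->
  is_derive (0 : R) 1 f d.
Proof.
move=> H.
have cv : h^-1 *: ((f \o shift 0) (h *: (1 : R)) - f 0) @[h --> (0 : R)^'] --> d.
  apply/cvgrPdist_lt => e /H[r r0 hr]; near=> h.
  rewrite /= distrC addr0 /GRing.scale/= mulr1; apply: hr.
    by near: h; exact: nbhs_dnbhs_neq.
  by near: h; exact: dnbhs0_lt.
apply: DeriveDef; first by apply/cvg_ex; exists d.
exact: cvg_lim.
Unshelve. all: by end_near. Qed.

(** Mean value theorem on the segment from 0 to h, in a form that covers both signs of h and h =
    0. *)
Lemma mvt_abs (f df : R -> R) (h : R) :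
  (forall x : R, `|x| <= `|h| -> is_derive x 1 f (df x)) ->
  exists2 c, `|c| <= `|h| & f h - f 0 = df c * h.
Proof.
move=> fd.
have cont a b : - `|h| <= a -> b <= `|h| -> {within `[a, b], continuous f}.
  move=> ha hb; apply: derivable_within_continuous => x.
  rewrite in_itv/= => /andP[ax xb].
  have [|] := fd x; last by [].
  by rewrite ler_norml (le_trans ha ax) (le_trans xb hb).
have nh : - `|h| <= h <= `|h| by rewrite -ler_norml.
have [h0|h0|->] := ltgtP h 0; last first.
- by exists 0; rewrite ?normr0// subrr mulr0.
- have [||c] := @MVT R f df 0 h h0.
  + move=> x; rewrite in_itv/= => /andP[x0 xh]; apply: fd.
    by rewrite !ger0_norm ?ltW.
  + by apply: cont; [rewrite oppr_le0|case/andP: nh].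
  rewrite in_itv/= subr0 => /andP[x0 xh] E; exists c => //.
  by rewrite !ger0_norm ?ltW.
- have [||c] := @MVT R f df h 0 h0.
  + move=> x; rewrite in_itv/= => /andP[x0 xh]; apply: fd.
    by rewrite !ltr0_norm ?lerN2 ?ltW.
  + by apply: cont; [case/andP: nh|].
  rewrite in_itv/= sub0r => /andP[x0 xh] E; exists c.
    by rewrite !ltr0_norm ?lerN2 ?ltW.
  by rewrite -[LHS]opprB E mulrN opprK.
Qed.

(** Joint continuity at the origin, with square neighbourhoods. *)
Definition continuous00 (g : R -> R -> R) := forall e, 0 < e ->
  exists2 r, 0 < r & forall s t : R, `|s| < r -> `|t| < r ->
  `|g s t - g 0 0| < e.

(** Split [f t t] as [f t 0] plus an increment in the second variable. By the mean value theorem the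
    increment is [f2 t c * t] with c between 0 and t, and joint continuity of [f2] gives its
    derivative at 0. *)
Lemma is_derive_diag (r a : R) (f f2 : R -> R -> R) : 0 < r ->
  is_derive (0 : R) 1 (f ^~ 0) a ->
  (forall s t : R, `|s| < r -> `|t| < r -> is_derive t 1 (f s) (f2 s t)) ->
  continuous00 f2 ->
  is_derive (0 : R) 1 (fun t => f t t) (a + f2 0 0).
Proof.
move=> r0 f1 fd cf.
have K : is_derive (0 : R) 1 (fun t => f t t - f t 0) (f2 0 0).
  apply: is_derive_dist => e e0; have [q q0 hq] := cf e e0.
  exists (Num.min r q); first by rewrite lt_min r0.
  move=> h h0; rewrite lt_min => /andP[hr hhq].
  have [c ch E] : exists2 c, `|c| <= `|h| & f h h - f h 0 = f2 h c * h.
    by apply: mvt_abs => x xh; apply: fd => //; exact: le_lt_trans hr.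
  rewrite subrr subr0 E mulrCA mulVf// mulr1; apply: hq => //.
  exact: le_lt_trans hhq.
apply: near_eq_is_derive (is_deriveD f1 K); near=> t.
by rewrite fctE addrC subrK.
Unshelve. all: by end_near. Qed.

(** The second difference of f over a square of side h is, by two mean value steps in either order,
    [h ^+ 2] times a value of [f12] and also [h ^+ 2] times a value of [f21]. Both points tend to
    the origin with h, and continuity there concludes. *)
Lemma schwarz (r : R) (f f1 f2 f12 f21 : R -> R -> R) : 0 < r ->
  (forall s t : R, `|s| < r -> `|t| < r -> is_derive s 1 (f ^~ t) (f1 s t)) ->
  (forall s t : R, `|s| < r -> `|t| < r -> is_derive t 1 (f s) (f2 s t)) ->
  (forall s t : R, `|s| < r -> `|t| < r -> is_derive t 1 (f1 s) (f12 s t)) ->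
  (forall s t : R, `|s| < r -> `|t| < r -> is_derive s 1 (f2 ^~ t) (f21 s t)) ->
  continuous00 f12 -> continuous00 f21 -> f12 0 0 = f21 0 0.
Proof.
move=> r0 d1 d2 d12 d21 c12 c21.
suff H e : 0 < e -> `|f12 0 0 - f21 0 0| < e + e.
  apply/eqP; rewrite -subr_eq0 -normr_eq0 eq_le normr_ge0 andbT leNgt.
  apply/negP => p0; have := H (`|f12 0 0 - f21 0 0| / 2).
  by rewrite divr_gt0// -splitr ltxx => /(_ isT).
move=> e0; have [q1 q10 h1] := c12 e e0; have [q2 q20 h2] := c21 e e0.
pose q := Num.min r (Num.min q1 q2); have q0 : 0 < q by rewrite !lt_min r0 q10.
pose h := q / 2; have h0 : 0 < h by rewrite divr_gt0.
have hq : `|h| < q by rewrite gtr0_norm// ltr_pdivrMr// mulr2n mulrDr mulr1 ltrDr.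
have hr (x : R) : `|x| <= `|h| -> [/\ `|x| < r, `|x| < q1 & `|x| < q2].
  by move=> /le_lt_trans/(_ hq); rewrite !lt_min => /and3P[].
have [z1 _ _] : [/\ `|0 : R| < r, `|0 : R| < q1 & `|0 : R| < q2] by apply: hr; rewrite normr0.
have [y1 _ _] := hr _ (lexx `|h|).
pose Delta := f h h - f h 0 - (f 0 h - f 0 0).
have [c ch E1] : exists2 c, `|c| <= `|h| & Delta = (f1 c h - f1 c 0) * h.
  apply: (@mvt_abs (fun s => f s h - f s 0) (fun s => f1 s h - f1 s 0)) => x /hr[xr _ _].
  by apply: is_deriveB; apply: d1.
have [c' ch' E1'] : exists2 c', `|c'| <= `|h| & f1 c h - f1 c 0 = f12 c c' * h.
  by apply: mvt_abs => x /hr[xr _ _]; apply: d12 => //; have [] := hr _ ch.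
have [b bh E2] : exists2 b, `|b| <= `|h| & Delta = (f2 h b - f2 0 b) * h.
  rewrite (_ : Delta = (f h h - f 0 h) - (f h 0 - f 0 0)); last by rewrite /Delta; ring.
  apply: (@mvt_abs (fun t => f h t - f 0 t) (fun t => f2 h t - f2 0 t)) => x /hr[xr _ _].
  by apply: is_deriveB; apply: d2.
have [b' bh' E2'] : exists2 b', `|b'| <= `|h| & f2 h b - f2 0 b = f21 b' b * h.
  apply: (@mvt_abs (f2 ^~ b) (f21 ^~ b)) => x /hr[xr _ _].
  by apply: d21 => //; have [] := hr _ bh.
have hn0 : h != 0 by rewrite gt_eqF.
have E : f12 c c' = f21 b' b.
  by apply: (mulIf hn0); apply: (mulIf hn0); rewrite -E1' -E2' -E1 -E2.
have [_ c1 _] := hr _ ch; have [_ c1' _] := hr _ ch'.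
have [_ _ b2] := hr _ bh; have [_ _ b2'] := hr _ bh'.
have k1 := h1 _ _ c1 c1'; have k2 := h2 _ _ b2' b2.
rewrite (_ : _ - _ = (f21 b' b - f21 0 0) - (f12 c c' - f12 0 0)); last first.
  by rewrite E; ring.
by apply: le_lt_trans (ler_normB _ _) _; rewrite addrC ltrD.
Qed.

End TwoVariables.

(** * Derivatives in real directions of a complex normed space *)

Section Directional.
Local Open Scope complex_scope.
Variables (R : realType) (V : normedModType R[i]).
Local Notation C := R[i].
Local Notation Re := (@complex.Re (Real.sort R)).
Local Notation Im := (@complex.Im (Real.sort R)).
Implicit Types (f g : V -> C) (D : set V) (x v w : V) (d e c : C).

Definition is_rderive v f x d : Prop :=
  is_cderive (fun t : R => f (x + t%:C *: v)) 0 d.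

Lemma rderivableP v f x : rderivable v f x -> is_rderive v f x (rderive v f x).
Proof. exact: cderivable1P. Qed.

Lemma is_rderive_val v f x d : is_rderive v f x d -> rderive v f x = d.
Proof. exact: is_cderive_val. Qed.

Lemma is_rderive_ex v f x d : is_rderive v f x d -> rderivable v f x.
Proof. exact: is_cderive_ex. Qed.

Lemma line0 x v : x + (0 : R)%:C *: v = x.
Proof. by rewrite (_ : (0 : R)%:C = 0 :> C)// scale0r addr0. Qed.

(** Norms and radii take values in [C]. Being nonnegative they are real, so the estimate is carried
    out on real parts. The 1 in [K] keeps the divisor positive when v and w vanish. *)
Lemma nbhs_plane x v w (A : set V) : nbhs x A ->
  exists2 r : R, 0 < r & forall s t : R, `|s| < r -> `|t| < r ->
    A (x + s%:C *: v + t%:C *: w).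
Proof.
move=> /nbhs_normP[q q0 qA].
have reN (u : V) : `|u| = (Re `|u|)%:C by rewrite RRe_real// normr_real.
have qE : q = (Re q)%:C by rewrite RRe_real// gtr0_real.
have q0' : 0 < Re q by move: q0; rewrite qE /= ltcR.
have p0 (u : V) : 0 <= Re `|u| by rewrite -lecR -reN normr_ge0.
pose K := Re `|v| + Re `|w| + 1.
have K0 : 0 < K by rewrite ltr_wpDl// addr_ge0.
exists (Re q / K); first by rewrite divr_gt0.
move=> s t sr tr; apply: qA => /=.
rewrite opprD opprD addrA addrA subrr add0r -opprD normrN.
apply: (@le_lt_trans _ _ (`|s| * Re `|v| + `|t| * Re `|w|)%:C).
  rewrite rmorphD !rmorphM /= -!reN.
  by rewrite (le_trans (ler_normD _ _))// !normrZ !normc_def/= !expr0n/= !addr0 !sqrtr_sqr.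
rewrite qE ltcR.
have h1 : `|s| * Re `|v| <= Re q / K * Re `|v| by rewrite ler_wpM2r// ltW.
have h2 : `|t| * Re `|w| <= Re q / K * Re `|w| by rewrite ler_wpM2r// ltW.
apply: le_lt_trans (lerD h1 h2) _.
rewrite -mulrDr -[ltRHS]mulr1 -mulrA ltr_pM2l// mulrC ltr_pdivrMr// mul1r.
by rewrite /K ltrDl.
Qed.

Lemma nbhs_line x v (A : set V) : nbhs x A ->
  \forall t \near (0 : R), A (x + t%:C *: v).
Proof.
move=> /(nbhs_plane v v)[r r0 rA]; apply/nbhs_normP; exists r => //= t /=.
by rewrite sub0r normrN => tr; have := rA t 0; rewrite line0 normr0; apply.
Qed.

Lemma is_rderive_near v f g x d : (\near x, f x = g x) ->
  is_rderive v f x d -> is_rderive v g x d.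
Proof. by move=> /(nbhs_line v); exact: is_cderive_near. Qed.

Lemma is_rderive_shift v f x (s : R) d : is_rderive v f (x + s%:C *: v) d ->
  is_cderive (fun t : R => f (x + t%:C *: v)) s d.
Proof.
have E t : x + s%:C *: v + t%:C *: v = x + (t + s)%:C *: v.
  by rewrite rmorphD scalerDl addrA addrAC.
move=> [h1 h2]; split; apply: is_derive_shift0.
  by apply: near_eq_is_derive h1; near=> t; rewrite E.
by apply: near_eq_is_derive h2; near=> t; rewrite E.
Unshelve. all: by end_near. Qed.

Lemma continuous_plane f x v w : {for x, continuous f} ->
  continuous00 (fun s t => Re (f (x + s%:C *: v + t%:C *: w))) /\
  continuous00 (fun s t => Im (f (x + s%:C *: v + t%:C *: w))).
Proof.
move=> fx.
have H (e : R) : 0 < e -> exists2 r : R, 0 < r & forall s t : R, `|s| < r ->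
    `|t| < r -> `|f (x + s%:C *: v + t%:C *: w) - f x| < e%:C.
  move=> e0; have e0' : 0 < e%:C by rewrite ltcR.
  have /(nbhs_plane v w)[r r0 rA] : nbhs x [set y | `|f x - f y| < e%:C].
    by move/cvgrPdist_lt: fx => /(_ _ e0').
  by exists r => // s t sr tr; rewrite distrC; exact: rA.
(* Up to sign, [Im z] is the real part of ['i * z], which has the same modulus as z. *)
have ImN (z : C) : (`|Im z|)%:C <= `|z|.
  have := normc_ge_Re ('i * z); rewrite normrM normCi mul1r.
  by case: z => a b /=; rewrite mul0r mul1r sub0r normrN.
split=> e /H[r r0 rA]; exists r => // s t sr tr; rewrite !line0.
  rewrite -ltcR; apply: le_lt_trans (rA s t sr tr).
  apply: le_trans (normc_ge_Re _).
  by rewrite ReD (_ : Re (- f x) = - Re (f x))//; case: (f x).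
rewrite -ltcR; apply: le_lt_trans (rA s t sr tr).
apply: le_trans (ImN _).
by rewrite ImD (_ : Im (- f x) = - Im (f x))//; case: (f x).
Qed.

(** [Ck_on] only speaks of single lines. The line in direction v + w is the diagonal of the plane
    through x spanned by v and w, so [is_derive_diag] applies to the real and imaginary parts. *)
Lemma is_rderive_add D f x v w : open D -> D x -> Ck_on 1 D f ->
  is_rderive (v + w) f x (rderive v f x + rderive w f x).
Proof.
move=> oD Dx [_ fC]; have [r r0 rD] := nbhs_plane v w (open_nbhs_nbhs (conj oD Dx)).
have [dv _] := fC v; have [dw [cw _]] := fC w.
have [c1 c2] := continuous_plane v w (cw x Dx).
have K : is_rderive v f x (rderive v f x) by apply: rderivableP; exact: dv.
have L (s t : R) : `|s| < r -> `|t| < r ->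
    is_cderive (fun t : R => f (x + s%:C *: v + t%:C *: w)) t
      (rderive w f (x + s%:C *: v + t%:C *: w)).
  by move=> sr tr; apply: is_rderive_shift; apply: rderivableP; apply: dw; exact: rD.
split.
  have := @is_derive_diag R r (Re (rderive v f x))
    (fun s t => Re (f (x + s%:C *: v + t%:C *: w)))
    (fun s t => Re (rderive w f (x + s%:C *: v + t%:C *: w))) r0.
  rewrite !line0 -ReD => H; apply: near_eq_is_derive (H _ _ c1).
  - by near=> t; rewrite scalerDr addrA.
  - by case: K => K _; apply: near_eq_is_derive K; near=> t; rewrite line0.
  - by move=> s t sr tr; have [] := L s t sr tr.
have := @is_derive_diag R r (Im (rderive v f x))
  (fun s t => Im (f (x + s%:C *: v + t%:C *: w)))
  (fun s t => Im (rderive w f (x + s%:C *: v + t%:C *: w))) r0.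
rewrite !line0 -ImD => H; apply: near_eq_is_derive (H _ _ c2).
- by near=> t; rewrite scalerDr addrA.
- by case: K => _ K; apply: near_eq_is_derive K; near=> t; rewrite line0.
- by move=> s t sr tr; have [] := L s t sr tr.
Unshelve. all: by end_near. Qed.

Lemma is_rderiveZ f x v (a : R) d : is_rderive v f x d ->
  is_rderive (a%:C *: v) f x (a%:C * d).
Proof.
have E (t : R) : x + (t * a)%:C *: v = x + t%:C *: (a%:C *: v).
  by rewrite rmorphM scalerA.
have ha : is_derive (0 : R) 1 (fun t : R => t * a) a.
  apply: (near_eq_is_derive _ (is_derive_eq (is_deriveZ a (is_derive_id (0 : R) 1)) _)).
    by near=> t; rewrite mulrC.
  by rewrite /GRing.scale/= mulr1.
have z : (0 : R) * a = 0 by rewrite mul0r.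
move=> [h1 h2]; split.
  rewrite -{1}z in h1; have := @is_derive1_comp R _ (fun t => t * a) 0 _ _ h1 ha.
  rewrite mulrC (_ : a * Re d = Re (a%:C * d)); last first.
    by case: (d) => ? ? /=; rewrite mul0r subr0.
  by apply: near_eq_is_derive; near=> t; rewrite /= E.
rewrite -{1}z in h2; have := @is_derive1_comp R _ (fun t => t * a) 0 _ _ h2 ha.
rewrite mulrC (_ : a * Im d = Im (a%:C * d)); last first.
  by case: (d) => ? ? /=; rewrite mul0r addr0.
by apply: near_eq_is_derive; near=> t; rewrite /= E.
Unshelve. all: by end_near. Qed.

(** Restriction to the plane [p] through x reduces this to [schwarz], once for the real part and
    once for the imaginary part. *)
Lemma rderiveC D f x v w : open D -> D x -> Ck_on 2 D f ->
  rderive v (rderive w f) x = rderive w (rderive v f) x.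
Proof.
move=> oD Dx [_ fC]; have [r r0 rD] := nbhs_plane v w (open_nbhs_nbhs (conj oD Dx)).
have [dv [_ /(_ w)[dwv [cwv _]]]] := fC v.
have [dw [_ /(_ v)[dvw [cvw _]]]] := fC w.
pose p (s t : R) := x + s%:C *: v + t%:C *: w.
have p00 : p 0 0 = x by rewrite /p !line0.
have pE s t : p s t = x + t%:C *: w + s%:C *: v by rewrite /p addrAC.
have V1 g (s t : R) : `|s| < r -> `|t| < r ->
    (forall y, D y -> rderivable v g y) ->
    is_cderive (fun s => g (p s t)) s (rderive v g (p s t)).
  move=> sr tr gd; apply: is_cderive_near (is_rderive_shift (x := x + t%:C *: w) _).
    by near=> u; rewrite pE.
  by rewrite -pE; apply: rderivableP; apply: gd; exact: rD.
have W1 g (s t : R) : `|s| < r -> `|t| < r ->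
    (forall y, D y -> rderivable w g y) ->
    is_cderive (fun t => g (p s t)) t (rderive w g (p s t)).
  by move=> sr tr gd; apply: is_rderive_shift; apply: rderivableP; apply: gd; exact: rD.
have [c1 c2] := continuous_plane v w (cwv x Dx).
have [b1 b2] := continuous_plane v w (cvw x Dx).
have ER : Re (rderive w (rderive v f) x) = Re (rderive v (rderive w f) x).
  have H := @schwarz R r (fun s t => Re (f (p s t)))
    (fun s t => Re (rderive v f (p s t))) (fun s t => Re (rderive w f (p s t)))
    (fun s t => Re (rderive w (rderive v f) (p s t)))
    (fun s t => Re (rderive v (rderive w f) (p s t))) r0.
  rewrite p00 in H; apply: (H _ _ _ _ c1 b1) => s t sr tr.
  - exact (proj1 (V1 f s t sr tr dv)).
  - exact (proj1 (W1 f s t sr tr dw)).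
  - exact (proj1 (W1 (rderive v f) s t sr tr dwv)).
  - exact (proj1 (V1 (rderive w f) s t sr tr dvw)).
have EI : Im (rderive w (rderive v f) x) = Im (rderive v (rderive w f) x).
  have H := @schwarz R r (fun s t => Im (f (p s t)))
    (fun s t => Im (rderive v f (p s t))) (fun s t => Im (rderive w f (p s t)))
    (fun s t => Im (rderive w (rderive v f) (p s t)))
    (fun s t => Im (rderive v (rderive w f) (p s t))) r0.
  rewrite p00 in H; apply: (H _ _ _ _ c2 b2) => s t sr tr.
  - exact (proj2 (V1 f s t sr tr dv)).
  - exact (proj2 (W1 f s t sr tr dw)).
  - exact (proj2 (W1 (rderive v f) s t sr tr dwv)).
  - exact (proj2 (V1 (rderive w f) s t sr tr dvw)).
by move: ER EI; case: (rderive v _ x) => a b; case: (rderive w _ x) => a' b' /= -> ->.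
Unshelve. all: by end_near. Qed.

End Directional.

(** * Smooth functions and Wirtinger calculus *)

Section Smooth.
Local Open Scope complex_scope.
Variables (R : realType) (V : normedModType R[i]).
Local Notation C := R[i].
Implicit Types (f g : V -> C) (D : set V) (x v w : V) (d e c : C).

(** This is what allows an identity valid on [D] to be differentiated, since derivatives depend only
    on germs. *)
Lemma near_open D f g x : open D -> D x -> (forall y, D y -> f y = g y) ->
  \near x, f x = g x.
Proof.
by move=> oD Dx fg; apply: filterS (open_nbhs_nbhs (conj oD Dx)) => y /fg.
Qed.

Lemma continuous_near f g x : (\near x, f x = g x) ->
  {for x, continuous f} -> {for x, continuous g}.
Proof.
move=> fg cf; apply/cvgrPdist_lt => e e0; near=> y.
rewrite -(nbhs_singleton fg) -(near fg y)//; near: y.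
by move/cvgrPdist_lt: cf => /(_ _ e0).
Unshelve. all: by end_near. Qed.

Lemma continuous_add f g x : {for x, continuous f} ->
  {for x, continuous g} -> {for x, continuous (fun y => f y + g y)}.
Proof. by move=> cf cg; exact: (cvgD cf cg). Qed.

Lemma continuous_scale c f x : {for x, continuous f} ->
  {for x, continuous (fun y => c * f y)}.
Proof.
move=> cf; apply/cvgrPdist_lt => e e0.
have c0 : 0 < `|c| + 1 by rewrite ltr_wpDl.
have e0' : 0 < e / (`|c| + 1) by rewrite divr_gt0.
near=> y; rewrite -mulrBr normrM.
apply: (@le_lt_trans _ _ ((`|c| + 1) * `|f x - f y|)).
  by rewrite ler_wpM2r// lerDl.
rewrite mulrC -ltr_pdivlMr//; near: y.
by move/cvgrPdist_lt: cf => /(_ _ e0').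
Unshelve. all: by end_near. Qed.

(** A pointwise first-order condition. It is enough for Leibniz rules and passes easily through
    products, determinants and inverses, hence to N. *)
Definition rdiff f x : Prop := forall v, rderivable v f x.

Lemma rdiffP f x v : rdiff f x -> is_rderive v f x (rderive v f x).
Proof. by move=> fx; exact: rderivableP. Qed.

Lemma rdiff_near f g x : (\near x, f x = g x) -> rdiff f x -> rdiff g x.
Proof.
by move=> fg fx v; apply: is_rderive_ex (is_rderive_near fg (rdiffP v fx)).
Qed.

Lemma rderive_near f g x v : (\near x, f x = g x) ->
  rderive v f x = rderive v g x.
Proof.
move=> /(nbhs_line v) fg; rewrite /rderive /cderive1 !derive1E.
by congr Complex; apply: near_eq_derive; near=> t; rewrite (near fg t).
Unshelve. all: by end_near. Qed.

Lemma Ck_on_eq k D f g : open D -> (forall x, D x -> f x = g x) ->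
  Ck_on k D f -> Ck_on k D g.
Proof.
move=> oD; elim: k f g => [|k IH] f g fg [cf fC].
  by split=> [x Dx|]; [apply: continuous_near (cf x Dx); exact: near_open fg|exact: I].
split=> [x Dx|v]; first by apply: continuous_near (cf x Dx); exact: near_open fg.
have [df dC] := fC v.
have E x : D x -> is_rderive v g x (rderive v f x).
  move=> Dx; apply: is_rderive_near (rderivableP (df x Dx)).
  exact: near_open fg.
split=> [x /E|]; first exact: is_rderive_ex.
by apply: IH dC => x /E /is_rderive_val.
Qed.

Lemma Ck_onD k D f g : open D -> Ck_on k D f -> Ck_on k D g ->
  Ck_on k D (fun x => f x + g x).
Proof.
move=> oD; elim: k f g => [|k IH] f g [cf fC] [cg gC].
  by split=> [x Dx|]; [exact: continuous_add (cf x Dx) (cg x Dx)|exact: I].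
split=> [x Dx|v]; first exact: continuous_add (cf x Dx) (cg x Dx).
have [df dfC] := fC v; have [dg dgC] := gC v.
have E x : D x -> is_rderive v (fun x => f x + g x) x (rderive v f x + rderive v g x).
  by move=> Dx; apply: is_cderiveD; apply: rderivableP; [exact: df|exact: dg].
split=> [x /E|]; first exact: is_rderive_ex.
by apply: Ck_on_eq oD _ (IH _ _ dfC dgC) => x /E /is_rderive_val.
Qed.

Lemma is_rderive_scale c f x v d : is_rderive v f x d ->
  is_rderive v (fun x => c * f x) x (c * d).
Proof.
by move=> h; have := is_cderiveM (is_cderive_cst c 0) h; rewrite mul0r add0r.
Qed.

Lemma Ck_on_scale k c D f : open D -> Ck_on k D f ->
  Ck_on k D (fun x => c * f x).
Proof.
move=> oD; elim: k f => [|k IH] f [cf fC].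
  by split=> [x Dx|]; [exact: continuous_scale (cf x Dx)|exact: I].
split=> [x Dx|v]; first exact: continuous_scale (cf x Dx).
have [df dfC] := fC v.
have E x : D x -> is_rderive v (fun x => c * f x) x (c * rderive v f x).
  by move=> Dx; apply: is_rderive_scale; apply: rderivableP; exact: df.
split=> [x /E|]; first exact: is_rderive_ex.
by apply: Ck_on_eq oD _ (IH _ dfC) => x /E /is_rderive_val.
Qed.

Lemma smooth_on_eq D f g : open D -> (forall x, D x -> f x = g x) ->
  smooth_on D f -> smooth_on D g.
Proof. by move=> oD fg fs k; exact: Ck_on_eq fg (fs k). Qed.

Lemma smooth_onD D f g : open D -> smooth_on D f -> smooth_on D g ->
  smooth_on D (fun x => f x + g x).
Proof. by move=> oD fs gs k; exact: Ck_onD. Qed.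

Lemma smooth_on_scale c D f : open D -> smooth_on D f ->
  smooth_on D (fun x => c * f x).
Proof. by move=> oD fs k; exact: Ck_on_scale. Qed.

Lemma smooth_on_rderive v D f : smooth_on D f -> smooth_on D (rderive v f).
Proof. by move=> fs k; have [_ /(_ v)[]] := fs k.+1. Qed.

Lemma smooth_on_rdiff D f x : smooth_on D f -> D x -> rdiff f x.
Proof. by move=> fs Dx v; have [_ /(_ v)[df _]] := fs 1%N; exact: df. Qed.

Lemma rdiff_cst c x : rdiff (fun=> c) x.
Proof. by move=> v; apply: is_cderive_ex (is_cderive_cst c 0). Qed.

Lemma rdiffM f g x : rdiff f x -> rdiff g x -> rdiff (fun x => f x * g x) x.
Proof.
move=> fx gx v.
exact: is_cderive_ex (is_cderiveM (rdiffP v fx) (rdiffP v gx)).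
Qed.

Lemma rdiffV f x : f x != 0 -> rdiff f x -> rdiff (fun x => (f x)^-1) x.
Proof.
move=> f0 fx v; have f0' : f (x + (0 : R)%:C *: v) != 0 by rewrite line0.
by have [d /is_cderive_ex] := is_cderiveV f0' (rdiffP v fx).
Qed.

Lemma rdiff_sum (I : Type) (r : seq I) (P : pred I) (F : I -> V -> C) x :
  (forall i, rdiff (F i) x) -> rdiff (fun x => \sum_(i <- r | P i) F i x) x.
Proof.
move=> Fx v.
exact: is_cderive_ex (is_cderive_sum r P (fun i => rdiffP v (Fx i))).
Qed.

Lemma rdiff_prod (I : Type) (r : seq I) (P : pred I) (F : I -> V -> C) x :
  (forall i, rdiff (F i) x) -> rdiff (fun x => \prod_(i <- r | P i) F i x) x.
Proof.
move=> Fx v; have [|d /is_cderive_ex//] := @is_cderive_prod R I r P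
  (fun i t => F i (x + t%:C *: v)) 0.
by move=> i; eexists; exact: (rdiffP v (Fx i)).
Qed.

Lemma rdiff_det m (A : V -> 'M[C]_m) x :
  (forall a b, rdiff (fun x => A x a b) x) -> rdiff (fun x => \det (A x)) x.
Proof.
move=> Ax; rewrite /determinant; apply: rdiff_sum => s.
by apply: rdiffM; [exact: rdiff_cst|exact: rdiff_prod].
Qed.

(** Cramer's rule. Invertibility is required around x because [invmx] returns the matrix itself when
    it is singular. *)
Lemma rdiff_invmx D m (A : V -> 'M[C]_m) x a b : open D -> D x ->
  (forall y, D y -> A y \in unitmx) ->
  (forall a b, rdiff (fun x => A x a b) x) ->
  rdiff (fun x => invmx (A x) a b) x.
Proof.
move=> oD Dx uA Ax.
apply: (@rdiff_near (fun y => (\det (A y))^-1 * cofactor (A y) b a)).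
  by apply: near_open oD Dx _ => y /uA uy; rewrite /invmx uy !mxE.
apply: rdiffM.
  apply: rdiffV; last exact: rdiff_det.
  by have := uA x Dx; rewrite unitmxE unitfE.
rewrite /cofactor; apply: rdiffM; first exact: rdiff_cst.
by apply: rdiff_det => i j; under eq_fun do rewrite !mxE; exact: Ax.
Qed.

(* [e = -'i] gives the Wirtinger derivative and [e = 'i] its conjugate. *)
Definition cpartial e v f x : C :=
  2^-1 * (rderive v f x + e * rderive ('i *: v) f x).

Lemma wirtinger_cpartial v : @wirtinger R V v = cpartial (- 'i) v.
Proof. by apply/funext => f; apply/funext => x; rewrite /cpartial mulNr. Qed.

Lemma cpartial_near e v f g x : (\near x, f x = g x) ->
  cpartial e v f x = cpartial e v g x.
Proof. by move=> fg; rewrite /cpartial !(rderive_near _ fg). Qed.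

Lemma cpartial_cst e v c x : cpartial e v (fun=> c) x = 0.
Proof.
have H w : rderive w (fun=> c) x = 0 := is_cderive_val (is_cderive_cst c 0).
by rewrite /cpartial !H mulr0 addr0 mulr0.
Qed.

Lemma cpartialD e v f g x : rdiff f x -> rdiff g x ->
  cpartial e v (fun x => f x + g x) x = cpartial e v f x + cpartial e v g x.
Proof.
move=> fx gx.
have H w : rderive w (fun x => f x + g x) x = rderive w f x + rderive w g x.
  by apply: is_rderive_val; apply: is_cderiveD; exact: rdiffP.
by rewrite /cpartial !H; ring.
Qed.

Lemma cpartialM e v f g x : rdiff f x -> rdiff g x ->
  cpartial e v (fun x => f x * g x) x =
  cpartial e v f x * g x + f x * cpartial e v g x.
Proof.
move=> fx gx.
have H w : rderive w (fun x => f x * g x) x =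
    rderive w f x * g x + f x * rderive w g x.
  by apply: is_rderive_val; have := is_cderiveM (rdiffP w fx) (rdiffP w gx);
     rewrite !line0.
by rewrite /cpartial !H; ring.
Qed.

Lemma cpartial_scale e v c f x : rdiff f x ->
  cpartial e v (fun x => c * f x) x = c * cpartial e v f x.
Proof.
move=> fx; rewrite (cpartialM _ _ (rdiff_cst c x) fx).
by rewrite cpartial_cst mul0r add0r.
Qed.

Lemma cpartial_sum e v (I : Type) (r : seq I) (P : pred I) (F : I -> V -> C) x :
  (forall i, rdiff (F i) x) ->
  cpartial e v (fun x => \sum_(i <- r | P i) F i x) x =
  \sum_(i <- r | P i) cpartial e v (F i) x.
Proof.
move=> Fx.
have H w : rderive w (fun x => \sum_(i <- r | P i) F i x) x =
    \sum_(i <- r | P i) rderive w (F i) x.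
  exact: is_cderive_val (is_cderive_sum r P (fun i => rdiffP w (Fx i))).
by rewrite /cpartial !H mulr_sumr -big_split /= mulr_sumr.
Qed.

Lemma smooth_on_cpartial e v D f : open D -> smooth_on D f ->
  smooth_on D (cpartial e v f).
Proof.
move=> oD fs; apply: smooth_on_scale => //; apply: smooth_onD => //.
  exact: smooth_on_rderive.
by apply: smooth_on_scale => //; exact: smooth_on_rderive.
Qed.

Lemma cpartialC D f e v e' w x : open D -> D x -> smooth_on D f ->
  cpartial e v (cpartial e' w f) x = cpartial e' w (cpartial e v f) x.
Proof.
move=> oD Dx fs.
have H u a z : rderive u (cpartial a z f) x =
    2^-1 * (rderive u (rderive z f) x + a * rderive u (rderive ('i *: z) f) x).
  have K z' : is_rderive u (rderive z' f) x (rderive u (rderive z' f) x).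
    by apply: rdiffP; apply: smooth_on_rdiff Dx; exact: smooth_on_rderive.
  apply: is_rderive_val; apply: is_rderive_scale.
  by apply: is_cderiveD; [exact: K|apply: is_rderive_scale; exact: K].
(* With the real second derivatives named [r u z], the claim becomes a polynomial identity modulo
   the symmetry of r. *)
have [r rE] : exists r, forall u z, rderive u (rderive z f) x = r u z.
  by exists (fun u z => rderive u (rderive z f) x).
have rC u z : r u z = r z u by rewrite -!rE; exact: rderiveC oD Dx (fs 2%N).
have E a u b z : cpartial a u (cpartial b z f) x =
    2^-1 * (2^-1 * (r u z + b * r u ('i *: z))
    + a * (2^-1 * (r ('i *: u) z + b * r ('i *: u) ('i *: z)))).
  by rewrite {1}/cpartial !H !rE.
rewrite !E (rC v w) (rC v ('i *: w)) (rC ('i *: v) w) (rC ('i *: v) ('i *: w)).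
by ring.
Qed.

Lemma wirtingerD D f x v w : open D -> D x -> smooth_on D f ->
  wirtinger (v + w) f x = wirtinger v f x + wirtinger w f x.
Proof.
move=> oD Dx fs; rewrite /wirtinger scalerDr.
rewrite !(is_rderive_val (is_rderive_add _ _ oD Dx (fs 1%N))).
by ring.
Qed.

(** The directional derivative is only real linear in v. Splitting c into real and imaginary parts
    and using ['i * 'i = -1], the Wirtinger combination is seen to be its complex linear part. *)
Lemma wirtingerZ D f x v c : open D -> D x -> smooth_on D f ->
  wirtinger (c *: v) f x = c * wirtinger v f x.
Proof.
move=> oD Dx fs; have fx := smooth_on_rdiff fs Dx.
have cE : c = (complex.Re c)%:C + (complex.Im c)%:C * 'i.
  by rewrite mulrC -complexE.
have i2 : 'i * 'i = -1 :> C by rewrite -expr2 sqr_i.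
have H u : rderive (c *: u) f x =
    (complex.Re c)%:C * rderive u f x + (complex.Im c)%:C * rderive ('i *: u) f x.
  rewrite {1}cE scalerDl -scalerA.
  rewrite (is_rderive_val (is_rderive_add _ _ oD Dx (fs 1%N))).
  by rewrite !(is_rderive_val (is_rderiveZ _ (rdiffP _ fx))).
have iC : 'i *: (c *: v) = c *: ('i *: v) by rewrite !scalerA mulrC.
rewrite /wirtinger iC !H scalerA i2 scaleN1r.
have -> : rderive (- v) f x = - rderive v f x.
  have := is_rderive_val (is_rderiveZ (-1) (rdiffP v fx)).
  by rewrite rmorphN rmorph1 scaleN1r mulN1r.
rewrite [in RHS]cE; move: (complex.Re c)%:C (complex.Im c)%:C => a b.
move: (rderive v f x) (rderive ('i *: v) f x) => p q.
by ring: i2.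
Qed.

Lemma wirtinger0 f x : wirtinger 0 f x = 0.
Proof.
have H : rderive 0 f x = 0.
  apply: is_rderive_val; apply: is_cderive_near (is_cderive_cst (f x) 0).
  by near=> t; rewrite scaler0 addr0.
by rewrite /wirtinger scaler0 H mulr0 subr0 mulr0.
Unshelve. all: by end_near. Qed.

Lemma wirtinger_sum D f x (I : Type) (r : seq I) (c : I -> C) (v : I -> V) :
  open D -> D x -> smooth_on D f ->
  wirtinger (\sum_(i <- r) c i *: v i) f x =
  \sum_(i <- r) c i * wirtinger (v i) f x.
Proof.
move=> oD Dx fs; elim: r => [|i r IH]; first by rewrite !big_nil wirtinger0.
by rewrite !big_cons (wirtingerD _ _ oD Dx fs) (wirtingerZ _ _ oD Dx fs) IH.
Qed.

End Smooth.

(** * Linear algebra in index form *)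

Section MatrixSums.
Variables (K : comUnitRingType) (m : nat).

(** For the row vector B this is [B *m invmx M *m M = B]. It turns a definition through the inverse
    Levi matrix into a linear system, for N and for [V^a_b] alike. *)
Lemma sum_invmx_mul (M : 'M[K]_m) (B : 'I_m -> K) d : M \in unitmx ->
  \sum_a (\sum_c invmx M c a * B c) * M a d = B d.
Proof.
move=> uM; under eq_bigr do rewrite mulr_suml.
have E c : \sum_a invmx M c a * M a d = (c == d)%:R.
  by have /matrixP/(_ c d) := mulVmx uM; rewrite !mxE.
rewrite exchange_big /= (bigD1 d)//= [X in _ + X]big1 => [|c cd].
  under eq_bigr do rewrite mulrAC.
  by rewrite -mulr_suml addr0 E eqxx mul1r.
under eq_bigr do rewrite mulrAC.
by rewrite -mulr_suml E (negPf cd) mul0r.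
Qed.

(** The algebra of lowering the index of a parallel A: the commutator is the derivative of A, and
    the last term is A times the derivative [L h] of the Levi matrix. The two terms of type [L A h]
    cancel. *)
Lemma sum_commutator (A L : 'I_m -> 'I_m -> K) (H : 'I_m -> K) b :
  \sum_a ((\sum_c A a c * L c b - \sum_c L a c * A c b) * H a
           + A a b * \sum_e L e a * H e) =
  \sum_c L c b * \sum_a A a c * H a.
Proof.
under eq_bigr do rewrite mulrBl.
rewrite big_split sumrB /=.
have -> : \sum_a A a b * (\sum_e L e a * H e) =
          \sum_a (\sum_c L a c * A c b) * H a.
  under eq_bigr do rewrite mulr_sumr.
  rewrite exchange_big /=; apply: eq_bigr => a _; rewrite mulr_suml.
  by apply: eq_bigr => c _; rewrite mulrCA mulrA.
rewrite subrK; under eq_bigr do rewrite mulr_suml.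
rewrite exchange_big /=; apply: eq_bigr => c _; rewrite mulr_sumr.
by apply: eq_bigr => a _; rewrite mulrAC mulrC mulrA.
Qed.

End MatrixSums.

(** * Euler identities and the connection in induced coordinates *)

Section LocalTheory.
Local Open Scope complex_scope.
Variables (R : realType) (n m : nat).
Local Notation C := R[i].
Local Notation P := ('rV[C]_n * 'rV[C]_m)%type.
Implicit Types (f g G : P -> C) (p q v : P).

Lemma d_zE k f : d_z k f = cpartial (- 'i) ((delta_mx 0 k, 0) : P) f.
Proof. by rewrite /d_z wirtinger_cpartial. Qed.

Lemma d_etaE a f : d_eta a f = cpartial (- 'i) ((0, delta_mx 0 a) : P) f.
Proof. by rewrite /d_eta wirtinger_cpartial. Qed.

Lemma d_etabarE a f : d_etabar a f = cpartial 'i ((0, delta_mx 0 a) : P) f.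
Proof. by []. Qed.

Lemma d_etaP a f p :
  d_eta a f p = cpartial (- 'i) ((0, delta_mx 0 a) : P) f p.
Proof. by rewrite d_etaE. Qed.

Lemma d_zP k f p : d_z k f p = cpartial (- 'i) ((delta_mx 0 k, 0) : P) f p.
Proof. by rewrite d_zE. Qed.

Definition fcoord (b : 'I_m) p : C := p.2 0 b.

Lemma is_rderive_fcoord b v p : is_rderive v (fcoord b) p (fcoord b v).
Proof.
apply: is_cderive_near (is_cderive_affine (fcoord b p) (fcoord b v) 0).
by near=> t; rewrite /fcoord /= !mxE.
Unshelve. all: by end_near. Qed.

Lemma rdiff_fcoord b p : rdiff (fcoord b) p.
Proof. by move=> v; exact: is_rderive_ex (is_rderive_fcoord b v p). Qed.

(** The factor is 1 for [e = - 'i] and 0 for [e = 'i]: the fibre coordinate is holomorphic. *)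
Lemma cpartial_fcoord e b v p :
  cpartial e v (fcoord b) p = 2^-1 * (1 + e * 'i) * fcoord b v.
Proof.
rewrite /cpartial !(is_rderive_val (is_rderive_fcoord _ _ _)).
by rewrite /fcoord /= !mxE; ring.
Qed.

Let i2 : 'i * 'i = -1 :> C. Proof. by rewrite -expr2 sqr_i. Qed.

Section Domain.
Variables (D : set P) (oD : open D).

Lemma d_z_etaC k b f p : D p -> smooth_on D f ->
  d_z k (d_eta b f) p = d_eta b (d_z k f) p.
Proof. by move=> Dp fs; rewrite d_zE !d_etaE d_zE (cpartialC _ _ _ _ oD Dp fs). Qed.

Lemma d_etaC a b f p : D p -> smooth_on D f ->
  d_eta a (d_eta b f) p = d_eta b (d_eta a f) p.
Proof. by move=> Dp fs; rewrite !d_etaE (cpartialC _ _ _ _ oD Dp fs). Qed.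

(** The Euler operator is the Wirtinger derivative in the radial direction, by complex linearity in
    the direction. *)
Lemma euler_wirtinger f p : D p -> smooth_on D f ->
  \sum_b fcoord b p * d_eta b f p = wirtinger ((0, p.2) : P) f p.
Proof.
move=> Dp fs.
have H := wirtinger_sum (index_enum 'I_m) (fun b => fcoord b p)
  (fun b => (0, delta_mx 0 b) : P) oD Dp fs.
rewrite /d_eta; apply: (etrans (esym H)); apply: (congr1 (fun v => wirtinger v f p)).
rewrite [in RHS](row_sum_delta p.2).
apply: (big_rec2 (fun (x : P) y => x = (0, y))) => // i y1 y2 _ ->.
apply: injective_projections => /=; last by [].
rewrite addr0; exact: scaler0.
Qed.

(** Differentiating an Euler identity: Leibniz on each summand, then commuting the two derivatives
    of f. The Euler identities for the derivatives of G below are instances, differing only in what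
    happens to the coefficients [eta^b]. *)
Lemma euler_cpartial f g e v p : D p -> smooth_on D f ->
  (forall q, D q -> \sum_b fcoord b q * d_eta b f q = g q) ->
  \sum_b cpartial e v (fcoord b) p * d_eta b f p +
  \sum_b fcoord b p * d_eta b (cpartial e v f) p = cpartial e v g p.
Proof.
move=> Dp fs fg.
have dfs b : rdiff (d_eta b f) p.
  by rewrite d_etaE; apply: smooth_on_rdiff Dp; exact: smooth_on_cpartial.
rewrite -(cpartial_near e v (near_open oD Dp fg)) cpartial_sum; last first.
  by move=> b; apply: rdiffM; [exact: rdiff_fcoord|exact: dfs].
rewrite -big_split; apply: eq_bigr => b _ /=.
rewrite (cpartialM _ _ (rdiff_fcoord b p) (dfs b)) !d_etaE.
by rewrite (cpartialC _ _ _ _ oD Dp fs).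
Qed.

Lemma leviE G p a b : levi G p a b = d_eta a (d_etabar b G) p.
Proof. by rewrite mxE. Qed.

Lemma levi_funE G a b : (fun p => levi G p a b) = d_eta a (d_etabar b G).
Proof. by apply/funext => p; rewrite leviE. Qed.

Section Homogeneous.
Variable (G : P -> C).
Hypothesis Gs : smooth_on D G.
Hypothesis Ghom : forall p (c : C), D p -> c != 0 ->
  G (p.1, c *: p.2) = c * c^* * G p.

(** Homogeneity is assumed for nonzero scalars only, and [1 + t c] is one for small t. *)
Lemma homogeneous_line p (c : C) : D p ->
  \forall t \near (0 : R), G (p + t%:C *: (c *: ((0, p.2) : P))) =
    (1 + t%:C * c) * (1 + t%:C * c)^* * G p.
Proof.
move=> Dp.
have n0 : nbhs (1 : C) [set z | z != 0].
  apply/nbhs_normP; exists 1 => //= z /=; apply: contraTneq => ->.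
  by rewrite subr0 normr1 ltxx.
have := nbhs_line c n0; apply: filterS => t /= tc.
rewrite -Ghom//; congr G.
apply/pair_equal_spec; split => /=; first by rewrite !scaler0 addr0.
by rewrite scalerA scalerDl scale1r.
Qed.

Lemma euler_homogeneous p : D p -> \sum_b fcoord b p * d_eta b G p = G p.
Proof.
move=> Dp; rewrite (euler_wirtinger Dp Gs) /wirtinger.
have H (c : C) : rderive (c *: ((0, p.2) : P)) G p = (c + c^*) * G p.
  apply: is_rderive_val.
  have h1 := is_cderive_affine 1 c 0.
  have e0 : 1 + (0 : R)%:C * c = 1 by rewrite (_ : (0 : R)%:C = 0)// mul0r addr0.
  have e1 : (1 : C)^* = 1 by rewrite /= oppr0.
  have := is_cderiveM (is_cderiveM h1 (is_cderive_conj h1)) (is_cderive_cst (G p) 0).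
  rewrite e0 e1 mulr1 mul1r mulr0 addr0.
  apply: is_cderive_near; have := homogeneous_line c Dp; apply: filterS => t.
  exact: esym.
have -> : rderive ((0, p.2) : P) G p = (1 + 1) * G p.
  have := H 1; rewrite scale1r => ->; congr (_ * _); congr (_ + _).
  exact: rmorph1.
have -> : rderive ('i *: ((0, p.2) : P)) G p = 0.
  have ci : Num.conj ('i : C) = - 'i.
    by apply/eqP; rewrite eq_complex/= oppr0 !eqxx.
  by rewrite H ci subrr mul0r.
by rewrite mulr0 subr0 mulrA mulVf ?mul1r// pnatr_eq0.
Qed.

Lemma smooth_d_etabar d : smooth_on D (d_etabar d G).
Proof. exact: smooth_on_cpartial. Qed.

Lemma smooth_levi a d : smooth_on D (d_eta a (d_etabar d G)).
Proof. by rewrite d_etaE; apply: smooth_on_cpartial => //; exact: smooth_d_etabar. Qed.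

Lemma euler_d_etabar d p : D p ->
  \sum_b fcoord b p * d_eta b (d_etabar d G) p = d_etabar d G p.
Proof.
move=> Dp; rewrite d_etabarE -(euler_cpartial _ _ Dp Gs euler_homogeneous).
rewrite [X in _ = X + _]big1 ?add0r// => b _.
by rewrite cpartial_fcoord i2 subrr mulr0 !mul0r.
Qed.

(** The only coefficient with a nonzero derivative is [eta^a]; its term equals the right-hand side
    of the differentiated identity and cancels it. In other words, the Levi matrix has degree 0 in
    eta. *)
Lemma euler_levi a d p : D p ->
  \sum_b fcoord b p * d_eta b (d_eta a (d_etabar d G)) p = 0.
Proof.
move=> Dp; have := euler_cpartial (- 'i) ((0, delta_mx 0 a) : P) Dp
  (smooth_d_etabar d) (@euler_d_etabar d).
rewrite -!(d_etaE a) (bigD1 a)//= [X in _ + X + _ = _ -> _]big1 => [|b ba].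
  rewrite cpartial_fcoord /fcoord/= mxE !eqxx mulNr i2 opprK mulr1.
  rewrite mulVf ?pnatr_eq0// mul1r addr0.
  by move/(canRL (addKr _)); rewrite addNr.
by rewrite cpartial_fcoord /fcoord/= mxE eqxx (negPf ba) mulr0 mul0r.
Qed.

Lemma euler_d_z_levi k d p : D p ->
  \sum_b fcoord b p * d_z k (d_eta b (d_etabar d G)) p = d_z k (d_etabar d G) p.
Proof.
move=> Dp; have := euler_cpartial (- 'i) ((delta_mx 0 k, 0) : P) Dp
  (smooth_d_etabar d) (@euler_d_etabar d).
rewrite -!(d_zE k) big1 => [|b _]; last first.
  by rewrite cpartial_fcoord /fcoord/= mxE mulr0 mul0r.
rewrite add0r => <-; apply: eq_bigr => b _.
by rewrite (d_z_etaC _ _ Dp (smooth_d_etabar d)).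
Qed.

Lemma levi_sym a b d p : D p ->
  d_eta b (d_eta a (d_etabar d G)) p = d_eta a (d_eta b (d_etabar d G)) p.
Proof. by move=> Dp; rewrite (d_etaC _ _ Dp (smooth_d_etabar d)). Qed.

(** By symmetry of third derivatives, eta contracts the vertical part of [delta_k] to
    [N^a eta^b d_b h_(a dbar) = 0], whatever the coefficients N are. This is why the connection of
    another function [G'] is allowed: the lemma is applied to V with the N of [F^2]. *)
Lemma euler_hdelta (G' : P -> C) k d p : D p ->
  \sum_b fcoord b p * hdelta G' k (fun q => levi G q b d) p =
  d_z k (d_etabar d G) p.
Proof.
move=> Dp.
have E b : fcoord b p * hdelta G' k (fun q => levi G q b d) p =
    fcoord b p * d_z k (d_eta b (d_etabar d G)) p -
    \sum_a nlconn G' a k p * (fcoord b p * d_eta b (d_eta a (d_etabar d G)) p).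
  have S a : fcoord b p * (nlconn G' a k p * d_eta a (d_eta b (d_etabar d G)) p) =
      nlconn G' a k p * (fcoord b p * d_eta b (d_eta a (d_etabar d G)) p).
    by rewrite mulrCA (levi_sym a b d Dp).
  rewrite /hdelta levi_funE mulrBr mulr_sumr.
  exact: (congr1 (fun z => _ - z) (eq_bigr _ (fun a _ => S a))).
rewrite (eq_bigr _ (fun b _ => E b)) sumrB (euler_d_z_levi k d Dp) exchange_big /=.
rewrite big1 ?subr0// => a _.
by rewrite -mulr_sumr (euler_levi a d Dp) mulr0.
Qed.

End Homogeneous.

Lemma rdiff_levi G a b p : smooth_on D G -> D p -> rdiff (fun p => levi G p a b) p.
Proof.
move=> Gs Dp; rewrite levi_funE.
by apply: smooth_on_rdiff Dp; exact: smooth_levi.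
Qed.

Lemma hdeltaM G k f g p : rdiff f p -> rdiff g p ->
  hdelta G k (fun q => f q * g q) p = hdelta G k f p * g p + f p * hdelta G k g p.
Proof.
move=> fp gp; rewrite /hdelta d_zE (cpartialM _ _ fp gp) -!(d_zE k).
have E a : nlconn G a k p * d_eta a (fun q => f q * g q) p =
  nlconn G a k p * d_eta a f p * g p + f p * (nlconn G a k p * d_eta a g p).
  rewrite (d_etaE a (fun q => _)) (cpartialM _ _ fp gp) -!(d_etaE a).
  by rewrite mulrDr mulrA [X in _ + X = _]mulrCA.
rewrite (eq_bigr _ (fun a _ => E a)) big_split -mulr_suml -mulr_sumr /=.
by rewrite mulrBl mulrBr addrACA opprD.
Qed.

Lemma hdelta_sum G k (I : Type) (r : seq I) (F : I -> P -> C) p :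
  (forall i, rdiff (F i) p) ->
  hdelta G k (fun q => \sum_(i <- r) F i q) p = \sum_(i <- r) hdelta G k (F i) p.
Proof.
move=> Fp; rewrite /hdelta d_zE cpartial_sum// sumrB; congr (_ - _).
  by apply: eq_bigr => i _; rewrite d_zE.
rewrite exchange_big; apply: eq_bigr => a _ /=.
by rewrite d_etaE cpartial_sum// mulr_sumr; apply: eq_bigr => i _; rewrite d_etaE.
Qed.

Lemma hdelta_near G k f g p : (\near p, f p = g p) ->
  hdelta G k f p = hdelta G k g p.
Proof.
move=> fg; rewrite /hdelta !d_zE (cpartial_near _ _ fg); congr (_ - _).
by apply: eq_bigr => a _; rewrite !d_etaE (cpartial_near _ _ fg).
Qed.

(** * Parallel deformations and the nonlinear connection *)

Section Connection.
Variable (G : P -> C).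
Hypothesis Gs : smooth_on D G.
Hypothesis Ghom : forall p (c : C), D p -> c != 0 ->
  G (p.1, c *: p.2) = c * c^* * G p.
Hypothesis Gunit : forall p, D p -> levi G p \in unitmx.

Lemma nlconn_levi k d p : D p ->
  \sum_a nlconn G a k p * levi G p a d = d_z k (d_etabar d G) p.
Proof.
move=> Dp; have := sum_invmx_mul (fun c => d_z k (d_etabar c G) p) d (Gunit Dp).
exact.
Qed.

Lemma rdiff_nlconn a k p : D p -> rdiff (nlconn G a k) p.
Proof.
move=> Dp; rewrite /nlconn; apply: rdiff_sum => c; apply: rdiffM.
  by apply: (rdiff_invmx _ _ oD Dp Gunit) => i j; exact: rdiff_levi.
rewrite d_zE; apply: smooth_on_rdiff Dp; apply: smooth_on_cpartial => //.
exact: smooth_d_etabar.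
Qed.

(** Differentiate the system [N^a h_(a dbar) = d_k d_dbar G] by [eta^b]. The Leibniz term
    [N^a d_b h_(a dbar)] equals [N^a d_a h_(b dbar)], which is exactly what [delta_k] subtracts. *)
Lemma hdelta_levi k b d p : D p ->
  hdelta G k (fun q => levi G q b d) p =
  \sum_a bott_coef G a b k p * levi G p a d.
Proof.
move=> Dp; rewrite /hdelta; apply/eqP; rewrite subr_eq; apply/eqP.
have := cpartial_near (- 'i) ((0, delta_mx 0 b) : P)
  (near_open oD Dp (@nlconn_levi k d)).
rewrite cpartial_sum => [E|a]; last first.
  by apply: rdiffM; [exact: rdiff_nlconn|exact: rdiff_levi].
rewrite levi_funE (d_z_etaC _ _ Dp (smooth_d_etabar Gs d)) d_etaE -E -big_split.
apply: eq_bigr => a _ /=.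
rewrite (cpartialM _ _ (rdiff_nlconn a k Dp) (rdiff_levi a d Gs Dp)).
by rewrite bott_coefE -!(d_etaE b) levi_funE (levi_sym Gs a b d Dp).
Qed.

(** Homogeneity of N is obtained without differentiating the inverse matrix in the scaling: after
    multiplication by the invertible h, both sides become [d_k d_dbar G], by [hdelta_levi] with
    [euler_hdelta] and by the defining system. *)
Lemma euler_bott a k p : D p ->
  \sum_b fcoord b p * bott_coef G a b k p = nlconn G a k p.
Proof.
move=> Dp.
suff E : \row_a (\sum_b fcoord b p * bott_coef G a b k p) = \row_a nlconn G a k p.
  by move/matrixP/(_ 0 a) : E; rewrite !mxE.
apply: (can_inj (mulmxK (Gunit Dp))); apply/matrixP => i d.
rewrite !mxE (eq_bigr _ (fun a _ => congr1 (fun z => z * levi G p a d) (mxE _ _ _ _))).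
rewrite [RHS](eq_bigr (fun a => nlconn G a k p * levi G p a d)); last first.
  by move=> a' _; rewrite mxE.
rewrite nlconn_levi//; under eq_bigr do rewrite mulr_suml.
rewrite exchange_big /= -[RHS](euler_hdelta Gs Ghom G k d Dp).
apply: eq_bigr => b _; rewrite hdelta_levi// mulr_sumr.
by apply: eq_bigr => a' _; rewrite mulrA.
Qed.

Variables (V : P -> C) (A : 'I_m -> 'I_m -> P -> C).
Hypothesis Vs : smooth_on D V.
Hypothesis Vhom : forall p (c : C), D p -> c != 0 ->
  V (p.1, c *: p.2) = c * c^* * V p.
Hypothesis AE : forall p, D p -> forall a b,
  A a b p = \sum_d invmx (levi G p) d a * levi V p b d.
Hypothesis A_parallel : forall p, D p -> forall a b k,
  nabla_end G A a b k p = 0.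

Lemma lower_end b d p : D p ->
  \sum_a A a b p * levi G p a d = levi V p b d.
Proof.
move=> Dp; transitivity
  (\sum_a (\sum_c invmx (levi G p) c a * levi V p b c) * levi G p a d).
  by apply: eq_bigr => a _; rewrite AE.
exact: (sum_invmx_mul (fun d => levi V p b d) d (Gunit Dp)).
Qed.

Lemma rdiff_end a b p : D p -> rdiff (A a b) p.
Proof.
move=> Dp.
apply: (@rdiff_near _ _ (fun p => \sum_d invmx (levi G p) d a * levi V p b d)).
  by apply: near_open oD Dp _ => q Dq; rewrite AE.
apply: rdiff_sum => d; apply: rdiffM; last exact: rdiff_levi.
by apply: (rdiff_invmx _ _ oD Dp Gunit) => i j; exact: rdiff_levi.
Qed.

Lemma hdelta_deformation k b d p : D p ->
  hdelta G k (fun q => levi V q b d) p =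
  \sum_c bott_coef G c b k p * levi V p c d.
Proof.
move=> Dp; rewrite -(hdelta_near G k (near_open oD Dp (@lower_end b d))).
rewrite hdelta_sum => [|a]; last first.
  by apply: rdiffM; [exact: rdiff_end|exact: rdiff_levi].
under [RHS]eq_bigr do rewrite -lower_end//.
rewrite -(sum_commutator (fun a b => A a b p) (fun a b => bott_coef G a b k p)
  (fun a => levi G p a d) b).
apply: eq_bigr => a _.
rewrite (hdeltaM _ _ (rdiff_end a b Dp) (rdiff_levi a d Gs Dp)) hdelta_levi//.
(* Parallelism enters here, as a formula for [delta_k] of the endomorphism. *)
rewrite (_ : hdelta G k (A a b) p = \sum_c A a c p * bott_coef G c b k p
  - \sum_c bott_coef G a c k p * A c b p)//.
have := A_parallel Dp a b k; rewrite /nabla_end => /eqP.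
by rewrite subr_eq0 => /eqP <-; rewrite addrK.
Qed.

Lemma nlconn_deformation k d p : D p ->
  \sum_a nlconn G a k p * levi V p a d = d_z k (d_etabar d V) p.
Proof.
move=> Dp; under eq_bigr do rewrite -euler_bott// mulr_suml.
rewrite exchange_big /= -[RHS](euler_hdelta Vs Vhom G k d Dp).
apply: eq_bigr => b _; rewrite hdelta_deformation// mulr_sumr.
by apply: eq_bigr => a' _; rewrite mulrA.
Qed.

End Connection.
End Domain.
End LocalTheory.

(** Uniqueness, the converse of [sum_invmx_mul]: any solution of the system is the one built from
    the inverse. *)
Lemma sum_invmx_solve (K : comUnitRingType) m (M : 'M[K]_m) (B N : 'I_m -> K) a :
  M \in unitmx -> (forall d, \sum_a N a * M a d = B d) ->
  \sum_c invmx M c a * B c = N a.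
Proof.
move=> uM NB; suff E : (\row_c B c) *m invmx M = \row_a N a.
  have /matrixP/(_ 0 a) := E; rewrite !mxE => <-.
  by apply: eq_bigr => c _; rewrite mxE mulrC.
apply: (can_inj (mulmxK uM)); rewrite mulmxKV//; apply/matrixP => i d.
by rewrite !mxE -NB; apply: eq_bigr => c _; rewrite mxE.
Qed.

(** * The affine family in induced coordinates *)

Section Affine.
Local Open Scope complex_scope.
Variables (R : realType) (n m : nat).
Local Notation C := R[i].
Local Notation P := ('rV[C]_n * 'rV[C]_m)%type.
Variables (D : set P) (oD : open D).

(** The form depends on G only through N, but through derivatives of N: [L] is a fibre derivative of
    N, and the curvature differentiates [L] again. Hence equality is assumed on the open set [D]. *)
Lemma chern_form_nlconn (G G' : P -> C) j p : D p ->
  (forall q, D q -> forall a k, nlconn G' a k q = nlconn G a k q) ->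
  chern_form G' j p = chern_form G j p.
Proof.
move=> Dp NE.
have LE q a b k : D q -> bott_coef G' a b k q = bott_coef G a b k q.
  move=> Dq; apply: (etrans (bott_coefE G' a b k q)).
  apply: (etrans (d_etaP b (nlconn G' a k) q)).
  apply: (etrans (cpartial_near _ _ (near_open oD Dq (fun y Dy => NE y Dy a k)))).
  exact: (esym (etrans (bott_coefE G a b k q) (d_etaP b (nlconn G a k) q))).
have B a b i e v : cpartial e v (bott_coef G' a b i) p = cpartial e v (bott_coef G a b i) p.
  exact: (cpartial_near e v (near_open oD Dp (fun y Dy => LE y a b i Dy))).
have KE a b i k : curv_coef G' a b i k p = curv_coef G a b i k p.
  apply: (congr1 -%R); rewrite /hdelta_bar.
  apply: (congr2 (fun x y : C => x - y) (B a b i 'i ((delta_mx 0 k, 0) : P))).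
  apply: eq_bigr => c _.
  exact: (congr2 (fun x y => x^* * y) (NE p Dp c k)
    (B a b i 'i ((0, delta_mx 0 c) : P))).
have QE : (fun a b => curv G' a b p) = (fun a b => curv G a b p).
  apply/funext => a; apply/funext => b.
  apply: eq_bigr => i _; apply: eq_bigr => k _.
  exact: (congr1 (fun z => z *: wedge (dz_form R i) (dzbar_form R k)) (KE a b i k)).
exact: (congr1 (fun Q : 'I_m -> 'I_m -> hform R n =>
  bidegree_part j j (form_det (fun a b : 'I_m =>
    (a == b)%:R *: hone R n - (2 * (pi : R)%:C * 'i)^-1 *: Q a b))) QE).
Qed.

Variables (G V : P -> C) (t : C).
Hypothesis Gs : smooth_on D G.
Hypothesis Vs : smooth_on D V.

Lemma d_etabar_affine d p : D p ->
  d_etabar d (fun q => G q + t * V q) p = d_etabar d G p + t * d_etabar d V p.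
Proof.
move=> Dp; have Gd := smooth_on_rdiff Gs Dp; have Vd := smooth_on_rdiff Vs Dp.
rewrite !d_etabarE (cpartialD _ _ Gd (rdiffM (rdiff_cst t p) Vd)).
by rewrite (cpartial_scale _ _ _ Vd).
Qed.

Lemma cpartial_etabar_affine e v d p : D p ->
  cpartial e v (d_etabar d (fun q => G q + t * V q)) p =
  cpartial e v (d_etabar d G) p + t * cpartial e v (d_etabar d V) p.
Proof.
move=> Dp; rewrite (cpartial_near e v (near_open oD Dp (@d_etabar_affine d))).
have Gd := smooth_on_rdiff (smooth_d_etabar oD Gs d) Dp.
have Vd := smooth_on_rdiff (smooth_d_etabar oD Vs d) Dp.
rewrite (cpartialD _ _ Gd (rdiffM (rdiff_cst t p) Vd)).
by rewrite (cpartial_scale _ _ _ Vd).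
Qed.

Lemma levi_affine a b p : D p ->
  levi (fun q => G q + t * V q) p a b = levi G p a b + t * levi V p a b.
Proof.
move=> Dp; apply: (etrans (leviE _ p a b)); apply: (etrans (d_etaP a _ p)).
apply: (etrans (cpartial_etabar_affine _ _ b Dp)).
exact: (esym (congr2 (fun x y => x + t * y) (etrans (leviE G p a b) (d_etaP a _ p))
  (etrans (leviE V p a b) (d_etaP a _ p)))).
Qed.

Lemma d_z_etabar_affine k d p : D p ->
  d_z k (d_etabar d (fun q => G q + t * V q)) p =
  d_z k (d_etabar d G) p + t * d_z k (d_etabar d V) p.
Proof.
move=> Dp; apply: (etrans (d_zP k _ p)).
apply: (etrans (cpartial_etabar_affine _ _ d Dp)).
exact: (esym (congr2 (fun x y => x + t * y) (d_zP k _ p) (d_zP k _ p))).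
Qed.

Lemma nlconn_affine a k p : D p ->
  (forall q, D q -> levi G q \in unitmx) ->
  levi (fun q => G q + t * V q) p \in unitmx ->
  (forall d, \sum_a nlconn G a k p * levi V p a d = d_z k (d_etabar d V) p) ->
  nlconn (fun q => G q + t * V q) a k p = nlconn G a k p.
Proof.
move=> Dp uG uGt VE; apply: (@sum_invmx_solve _ _ _
  (fun c => d_z k (d_etabar c (fun q => G q + t * V q)) p)
  (fun c => nlconn G c k p) a uGt) => d.
apply: (etrans _ (esym (d_z_etabar_affine k d Dp))).
apply: (etrans _ (congr2 (fun x y => x + t * y) (nlconn_levi uG k d Dp) (VE d))).
rewrite mulr_sumr -big_split; apply: eq_bigr => c _ /=.
apply: (etrans (congr1 (fun x => nlconn G c k p * x) (levi_affine c d Dp))).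
by rewrite mulrDr mulrCA.
Qed.

End Affine.

(** * From the bundle to induced coordinates *)

Section Bundle.
Local Open Scope complex_scope.
Variables (R : realType) (n m : nat).
Variables (X : complexManifold R n) (E : holoBundle X m).
Local Notation C := R[i].
Local Notation P := ('rV[C]_n * 'rV[C]_m)%type.

(** The base part is the open chart image cut by the preimage of [fdom s] under the continuous
    inverse chart. In the fibre, the ball of radius [|p.2|] around [p.2] avoids 0. *)
Lemma open_slit_dom (c : chart R X n) (s : frame E m) : open (slit_dom c s).
Proof.
rewrite openE => p [[x [cx sx] xp] p0].
have h1 : \forall z \near p.1, (chart_map c @` (chart_dom c `&` fdom s)) z.
  have u1 : nbhs p.1 (chart_map c @` chart_dom c).
    by apply: open_nbhs_nbhs; split; [exact: chart_codom_open|exists x].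
  have u2 : nbhs p.1 (chart_inv c @^-1` fdom s).
    rewrite -xp; apply: (chart_inv_cont cx); rewrite chart_mapK//.
    by apply: open_nbhs_nbhs; split=> //; exact: fdom_open.
  near=> z; have [y cy yz] : (chart_map c @` chart_dom c) z by near: z.
  exists y => //; split=> //; rewrite -(chart_mapK cy) yz.
  by near: z.
have h2 : \forall z \near p.2, z <> 0.
  apply/nbhs_normP; exists `|p.2|; first by rewrite /= normr_gt0; apply/eqP.
  by move=> z /= pz z0; move: pz; rewrite z0 subr0 ltxx.
by exists ([set z | (chart_map c @` (chart_dom c `&` fdom s)) z], [set z | z <> 0]).
Unshelve. all: by end_near. Qed.

(** A nonzero row vector killed by M would make the form vanish on it. *)
Lemma levi_unitmx (M : 'M[C]_m) :
  (forall u : 'rV[C]_m, u != 0 ->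
    0 < \sum_(a < m) \sum_(b < m) M a b * u 0 a * (u 0 b)^*) -> M \in unitmx.
Proof.
move=> pM; rewrite unitmxE unitfE; apply/det0P => -[u u0 uM].
have := pM u u0; rewrite exchange_big big1 ?ltxx//= => b _.
rewrite -mulr_suml; have /matrixP/(_ 0 b) := uM; rewrite !mxE => uMb.
by under eq_bigr do rewrite mulrC; rewrite uMb mul0r.
Qed.

Lemma local_expr_homogeneous (F : forall x, E x -> R) c s (p : P) (l : C) :
  complex_finsler F -> l != 0 ->
  local_expr c s (sq F) (p.1, l *: p.2) = l * Num.conj l * local_expr c s (sq F) p.
Proof.
move=> FF l0; rewrite /local_expr /sq /=.
under eq_bigr do rewrite mxE -scalerA.
rewrite -scaler_sumr !rmorphXn /= (finsler_homogeneous FF)//.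
by rewrite exprMn normCK.
Qed.

End Bundle.

Theorem proposition4 (R : realType) (n m : nat)
    (X : complexManifold R n) (X_compact : compact [set: X])
    (E : holoBundle X m)
    (F : forall x, E x -> R) (F_finsler : complex_finsler F)
    (Ft : R -> forall x, E x -> R) (T : set R) (T_nbhs : nbhs (0 : R) T)
    (Ft_linear : forall t, T t -> forall x (v : E x),
       Ft t x v ^+ 2 = F x v ^+ 2 + t * inf_deformation Ft v)
    (Ft_finsler : forall t, T t -> complex_finsler (Ft t))
    (V_parallel : forall c s, local_coords X c -> local_frame E s ->
       forall p, slit_dom c s p -> forall a b k,
       nabla_end (local_expr c s (sq F)) (end_deformation c s F Ft) a b k p
       = 0) :
  forall t, T t -> forall j, (j <= m)%N ->
  forall (c : chart R X n) (s : frame E m),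
  local_coords X c -> local_frame E s -> forall p, slit_dom c s p ->
    chern_form (local_expr c s (sq (Ft t))) j p =
    chern_form (local_expr c s (sq F)) j p.
Proof.
move=> t Tt j _ c s Xc Es p Dp.
set G := local_expr c s (sq F).
pose V := local_expr c s (inf_deformation Ft).
have oD := @open_slit_dom _ _ _ _ _ c s; set D := slit_dom c s in oD Dp.
have GtE u : T u -> local_expr c s (sq (Ft u)) = fun q => G q + (u%:C)%C * V q.
  move=> Tu; apply/funext => q; rewrite /G /V /local_expr /sq.
  by rewrite (Ft_linear _ Tu) rmorphD; apply: (congr1 (fun z => _ + z)); exact: rmorphM.
(* One nonzero parameter lets V be solved for as [(F_t0^2 - F^2) / t0], which makes it smooth and
   homogeneous. *)
have [t0 Tt0 t00] : exists2 u : R, T u & u != 0.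
  have /nbhs_normP[r /= r0 rT] := T_nbhs.
  exists (r / 2); last by rewrite gt_eqF// divr_gt0.
  by apply: rT; rewrite /= sub0r normrN gtr0_norm ?divr_gt0// ltr_pdivrMr// ltr_pMr// ltr1n.
pose H := local_expr c s (sq (Ft t0)).
have VE q : V q = ((t0^-1)%:C)%C * (H q + (-1) * G q).
  rewrite /H (GtE t0 Tt0) mulN1r addrAC subrr add0r mulrA -rmorphM mulVf//.
  by rewrite rmorph1 mul1r.
have Gs : smooth_on D G := finsler_smooth F_finsler Xc Es.
have Hs : smooth_on D H := finsler_smooth (Ft_finsler t0 Tt0) Xc Es.
have Vs : smooth_on D V.
  apply: (smooth_on_eq oD (f := fun q => ((t0^-1)%:C)%C * (H q + (-1) * G q))).
    by move=> q _; rewrite VE.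
  apply: smooth_on_scale => //; apply: smooth_onD => //.
  exact: smooth_on_scale.
have Ghom q (l : R[i]) : D q -> l != 0 -> G (q.1, l *: q.2) = l * Num.conj l * G q.
  by move=> _ l0; exact: local_expr_homogeneous.
have Vhom q (l : R[i]) : D q -> l != 0 -> V (q.1, l *: q.2) = l * Num.conj l * V q.
  move=> Dq l0; rewrite !VE Ghom// /H local_expr_homogeneous//; last exact: Ft_finsler.
  by ring.
have unit_levi F' : complex_finsler F' -> forall q, D q ->
    levi (local_expr c s (sq F')) q \in unitmx.
  by move=> FF q Dq; apply: levi_unitmx => u u0; exact: (finsler_pseudoconvex FF Xc Es Dq).
have Gunit := unit_levi F F_finsler.
(* For parameters in [T], hence near 0, the Levi matrix of [F_u^2] is affine in u with slope
   [levi V]. The deformation of the Levi matrix, defined as a derivative at u = 0, is therefore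
   [levi V]. *)
have AE q : D q -> forall a b, end_deformation c s F Ft a b q =
    \sum_d invmx (levi G q) d a * levi V q b d.
  move=> Dq a b; apply: eq_bigr => d _; congr (_ * _).
  apply: is_cderive_val; apply: (is_cderive_near _
    (is_cderive_affine (levi G q b d) (levi V q b d) 0)).
  apply: filterS T_nbhs => u Tu; rewrite (GtE u Tu); apply: esym.
  exact: (levi_affine oD _ Gs Vs).
rewrite (GtE t Tt); apply: (chern_form_nlconn oD j Dp) => q Dq a k.
have uGt : levi (fun q => G q + (t%:C)%C * V q) q \in unitmx.
  by rewrite -(GtE t Tt); apply: unit_levi Dq; exact: Ft_finsler.
apply: (nlconn_affine oD Gs Vs a Dq Gunit uGt) => d.
exact: (nlconn_deformation oD Gs Ghom Gunit Vs Vhom AE (V_parallel c s Xc Es) k d Dq).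
Qed.
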